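(* Let $F$ (patience time distribution) be Lipschitz continuous, let $G$ (service time distribution) be continuous with finite mean $1/\mu$, let $\lambda\ge 0$ be the arrival rate function, and let $(\bar{\mathcal R}(0),\bar{\mathcal Z}(0))$ be a valid initial state. Then there exists a unique solution $\{(\bar{\mathcal R}(t),\bar{\mathcal Z}(t))\}_{t\ge 0}$, with this initial state, to the measure-valued fluid model tracking residual times; that is, a unique pair of measure-valued functions such that for all $t\ge 0$ $$\bar{\mathcal R}(t)(C_x)=\int_{t-\omega(t)}^t F^c(x+t-s)\,d\bar E(s),\quad x\in\mathbb R,$$ $$\bar{\mathcal Z}(t)(C_x)=\bar{\mathcal Z}(0)(C_{x+t})+\int_0^t F^c(\omega(s))\,G^c(x+t-s)\,d\bar B(s),\quad x\in[0,\infty),$$ $$\bar Q(t)=(\bar X(t)-1)^+,\qquad \bar Z(t)=\bar X(t)\wedge 1,$$ where $\omega,\bar B,\bar Q,\bar Z,\bar X$ are the processes derived from $(\bar{\mathcal R},\bar{\mathcal Z})$ and $\bar E$ as in the context.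
   Context: Notation: $C_x=(x,\infty)$, $a^+=\max(a,0)$, $a\wedge b=\min(a,b)$. $F$ and $G$ are distribution functions of nonnegative random variables, $F^c=1-F$, $G^c=1-G$ (so $F^c(x)=1$ for $x<0$). Arrivals: $\lambda\ge0$ is a locally integrable arrival rate, defined also for negative times (the initial fluid arrived during $(-\omega(0),0)$); $\bar E(t)=\int_0^t\lambda(s)\,ds$, extended to negative $t$, so $d\bar E(s)=\lambda(s)\,ds$. State: $\bar{\mathcal R}(t)$ is a finite measure on $\mathbb R$ ($\bar{\mathcal R}(t)(C_x)$ is the amount of fluid in the virtual buffer with remaining patience time larger than $x\in\mathbb R$), and $\bar{\mathcal Z}(t)$ is a finite measure on $(0,\infty)$ ($\bar{\mathcal Z}(t)(C_x)$ is the amount of fluid in service with remaining service time larger than $x\ge0$). Derived processes: $\bar R(t)=\bar{\mathcal R}(t)(\mathbb R)$, $\bar Q(t)=\bar{\mathcal R}(t)(C_0)$, $\bar Z(t)=\bar{\mathcal Z}(t)(C_0)$, $\bar X(t)=\bar Q(t)+\bar Z(t)$; $\omega(t)\in[0,t+\omega(0)]$ is the solution of $\bar R(t)=\int_{t-\omega(t)}^t d\bar E(s)$; and $\bar B(t)=\bar E(t)-\bar R(t)=\bar E(t-\omega(t))$. Where this equation does not determine $\omega(t)$ uniquely, $\omega(t)$ is taken so that $\omega(t)=F_{d,t}^{-1}(\bar Q(t))$ for all $t\ge 0$ (including $t=0$), where $F_{d,t}(x)=\int_0^xF^c(s)\lambda(t-s)\,ds$ for $x\in[0,t+\omega(0)]$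 and $F_{d,t}^{-1}(y)=\inf\{x\ge0:F_{d,t}(x)\ge y\}$. Valid initial state: $(\bar{\mathcal R}(0),\bar{\mathcal Z}(0))$ has no atoms, satisfies $\bar{\mathcal R}(0)(C_x)=\int_{-\omega(0)}^0F^c(x-s)\lambda(s)\,ds$ for $x\in\mathbb R$, and satisfies the non-idling constraints $\bar Q(0)=(\bar X(0)-1)^+$, $\bar Z(0)=\bar X(0)\wedge1$.
   Formalization: A solution is also required to have B̄ nondecreasing and right-continuous, so that dB̄ is a measure; with integrators of bounded variation uniqueness fails when F has bounded support, since ω may jump up to the end of the support. *)

(* Defs.v *)
From mathcomp Require Import all_boot all_order all_algebra.
From mathcomp Require Import all_classical all_reals all_analysis.

Set Implicit Arguments.
Unset Strict Implicit.
Unset Printing Implicit Defensive.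

Import Order.TTheory GRing.Theory Num.Theory.
Import numFieldNormedType.Exports.

Local Open Scope classical_set_scope.
Local Open Scope ring_scope.

Section FluidModel.
Context {R : realType}.

Local Notation leb := (@lebesgue_measure R).

Definition dist_fun (d : measure_display) (T : measurableType d)
    (P : probability T R) (V : {RV P >-> R}) (x : R) : R :=
  fine (cdf V x).

Definition compl_dist (F : R -> R) (x : R) : R := 1 - F x.

(* C_x = (x, oo) *)
Definition halfline (x : R) : set R := `]x, +oo[%classic.

(* \bar E(t), the integral of lam from 0 to t, oriented when t < 0 *)
Definition cum_arrivals (lam : R -> R) (t : R) : R :=
  if 0 <= t then Rintegral leb `]0, t] lam
  else - Rintegral leb `]t, 0] lam.

Definition fin_meas : Type :=
  {finite_measure set (measurableTypeR R) -> \bar R}.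

(* \bar R, \bar Q, \bar Z and \bar X at a fixed time *)
Definition buffer_mass (Rm : fin_meas) : R := fine (Rm setT).
Definition queue_mass (Rm : fin_meas) : R := fine (Rm (halfline 0)).
Definition service_mass (Zm : fin_meas) : R := fine (Zm (halfline 0)).
Definition system_mass (Rm Zm : fin_meas) : R :=
  queue_mass Rm + service_mass Zm.

(* F_{d,t}(x) *)
Definition Fd (F lam : R -> R) (t x : R) : R :=
  Rintegral leb `]0, x] (fun s => compl_dist F s * lam (t - s)).

(* F_{d,t}^{-1}(y), for F_{d,t} with domain [0, t + w0] *)
Definition Fd_inv (F lam : R -> R) (w0 t y : R) : R :=
  inf [set x | 0 <= x <= t + w0 /\ y <= Fd F lam t x].

(* w is \omega(t) when the virtual buffer is in state Rm at time t and
   \omega(0) = w0.  The last clause selects one solution of the second: it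
   matters where lam vanishes, and also when F has bounded support, since fluid
   all of whose patience has expired is not seen by the queue content. *)
Definition is_omega (F lam : R -> R) (w0 t : R) (Rm : fin_meas) (w : R) : Prop :=
  [/\ 0 <= w <= t + w0,
      buffer_mass Rm = Rintegral leb `]t - w, t] lam &
      w = Fd_inv F lam w0 t (queue_mass Rm)].

Definition non_idling (Rm Zm : fin_meas) : Prop :=
  queue_mass Rm = Num.max (system_mass Rm Zm - 1) 0 /\
  service_mass Zm = Num.min (system_mass Rm Zm) 1.

(* Finite measures on (0, oo) are encoded as measures on the line giving no
   mass to the complement. *)
Definition on_positive (Zm : fin_meas) : Prop := Zm `]-oo, 0]%classic = 0%E.

Definition no_atoms (m : fin_meas) : Prop := forall x : R, m [set x] = 0%E.

Definition valid_initial_state (F lam : R -> R) (w0 : R) (R0 Z0 : fin_meas)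
    : Prop :=
  [/\ on_positive Z0,
      no_atoms R0 /\ no_atoms Z0,
      is_omega F lam w0 0 R0 w0,
      forall x : R, R0 (halfline x) =
        (\int[leb]_(s in `](- w0)%R, 0%R])
           (compl_dist F (x - s) * lam s)%:E)%E &
      non_idling R0 Z0].

(* The integral against d\bar B is a Lebesgue-Stieltjes integral: B is the
   cumulative amount of fluid that has left the virtual buffer, so it has to be
   nondecreasing and right-continuous on [0, oo).  This is expressed by a
   cumulative function on the line that agrees with \bar E - \bar R there; its
   values at negative times play no role, as only ]0, t] is integrated over.
   Monotonicity cannot be relaxed to bounded variation: when F has bounded
   support, \omega could then jump up to the end of the support, at no cost in
   the equation for the service measure since F^c vanishes there. *)
Definition fluid_solution (F G lam : R -> R) (w0 : R) (R0 Z0 : fin_meas)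
    (Rt Zt : R -> fin_meas) : Prop :=
  exists (w : R -> R) (B : cumulative R R),
    (forall A : set (measurableTypeR R), measurable A ->
       Rt 0 A = R0 A /\ Zt 0 A = Z0 A) /\
    forall t : R, 0 <= t ->
      [/\ on_positive (Zt t),
          is_omega F lam w0 t (Rt t) (w t) /\
          B t = cum_arrivals lam t - buffer_mass (Rt t),
          forall x : R, Rt t (halfline x) =
            (\int[leb]_(s in `](t - w t)%R, t])
               (compl_dist F (x + t - s) * lam s)%:E)%E,
          forall x : R, 0 <= x -> Zt t (halfline x) =
            (Zt 0%R (halfline (x + t)%R) +
             \int[lebesgue_stieltjes_measure B]_(s in `]0%R, t])
               (compl_dist F (w s) * compl_dist G (x + t - s))%:E)%E &
          non_idling (Rt t) (Zt t)].

End FluidModel.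

Arguments fin_meas R : clear implicits.

(* Main.v *)
From HB Require Import structures.
Require Import Defs.
From mathcomp Require Import all_boot all_order all_algebra.
From mathcomp Require Import all_classical all_reals all_analysis.
From mathcomp Require Import measurable_realfun ring lra.

(* Write E for the cumulative arrivals, a(t) = t - w(t) for the arrival time of
   the fluid at the head of the virtual buffer and J(t, x) for the oriented
   integral of F^c(t - u) lam(u) over [0, x]. The model reduces to a system for
   the real functions a, Q, Z and K, the fluid that has entered service:
     Q(t) = J(t, t) - J(t, a(t)),
     J(t, a(t)) - J(t, a(s)) <= K(t) - K(s) <= J(s, a(t)) - J(s, a(s))
   for s <= t, Z = Z_0(C_t) + K - G * K, and Q (1 - Z) = 0 with Z <= 1. The two
   inequalities determine the measure dK = F^c(w) dB because F is Lipschitz: the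
   gap between them is at most L (t - s) (B(t) - B(s)), which disappears when
   summed over fine partitions. Abandonment is nondecreasing in the queue
   content, so for two solutions |Q + Z - Q' - Z'| <= 2 sup |G * (K - K')|;
   since G(0) = 0, this makes K - K' vanish on successive short intervals. For
   existence, a discrete-time first-come first-served scheme satisfies the
   inequalities exactly, and these pass to the pointwise limit of the schemes
   along an ultrafilter as the time step tends to 0. *)

Set Implicit Arguments.
Unset Strict Implicit.
Unset Printing Implicit Defensive.

Import Order.TTheory GRing.Theory Num.Theory.
Import numFieldNormedType.Exports.

Local Open Scope classical_set_scope.
Local Open Scope ring_scope.

(** The scalar system consists of equations and non-strict inequalities between values of [a], [Q],
    [K], [Z] and [c], so that nearly all of it passes to a pointwise limit without equicontinuity of
    the schemes. The exception is the maximality of the head position [a t], which encodes [Fd_inv].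
    The limit of the discrete heads may lie to the left of the maximal position; it is replaced by
    the latter, and this must not change [E (a t)]. The danger is a bounded support of F: fluid
    whose patience has run out is invisible to Q, and [J t] is flat there. Hence the recurring
    estimate that a wait never exceeds a nonnegative zero of [Fc]. The same degeneracy affects the
    passage between K and dB: K controls B only where [Fc (w)] is positive, so the continuity of B,
    without which the gap between the two inequalities would not vanish, needs its own proof: by
    excluding atoms of dB for a given fluid solution, and from the uniform continuity of K for the
    constructed one. *)

(** * Uniform continuity, fine partitions and ultralimits *)

Definition unif_cont_on (R : realType) (f : R -> R) (x y : R) : Prop :=
  forall e, 0 < e -> exists2 d, 0 < d &
    forall r s, x <= r -> r <= s -> s <= y -> s - r <= d -> `|f s - f r| <= e.

Lemma continuous_unif_cont_on (R : realType) (f : R -> R) (x y : R) :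
  continuous f -> unif_cont_on f x y.
Proof.
move=> cf e e0.
have /compact_near_coveringP := @segment_compact R x y.
move=> /(_ R (0^'+) (fun d r => forall s, `|s - r| <= d -> `|f s - f r| <= e)).
case=> [r0 _|d /= d0 Hd].
  have e20 : 0 < e / 2 by rewrite divr_gt0.
  have /cvgrPdist_lt /(_ _ e20) [eta /= eta0 Heta] := cf r0.
  exists (ball r0 (eta / 2), [set d : R | d < eta / 2]) => /=.
    split; first by exists (eta / 2) => //=; rewrite divr_gt0.
    exists (eta / 2) => /=; first by rewrite divr_gt0.
    by move=> d /= + d0; rewrite sub0r normrN gtr0_norm.
  move=> [r d] /= [r0r deta] s srd.
  have H1 : `|f r0 - f r| < e / 2.
    by apply: Heta => /=; apply: lt_trans r0r _; lra.
  have H2 : `|f r0 - f s| < e / 2.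
    apply: Heta => /=; rewrite -(subrK r r0) -addrA.
    apply: le_lt_trans (ler_normD _ _) _.
    move: r0r srd; rewrite /ball /= (distrC s r); lra.
  rewrite -(subrK (f r0) (f s)) -addrA.
  apply: le_trans (ler_normD _ _) _.
  by rewrite (distrC (f s)); lra.
exists (d / 2); first by rewrite divr_gt0.
move=> r s xr rs sy sr.
have := Hd (d / 2); rewrite /= sub0r normrN gtr0_norm ?divr_gt0//.
move=> /(_ _ _ r) /=; apply => //; first by rewrite ltr_pdivrMr// ltr_pMr// ltr1n.
  by rewrite in_itv /= xr (le_trans rs).
by rewrite ger0_norm// subr_ge0.
Qed.

Lemma unif_cont_onW (R : realType) (f : R -> R) (x y x' y' : R) :
  x <= x' -> y' <= y -> unif_cont_on f x y -> unif_cont_on f x' y'.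
Proof.
move=> xx yy fu e /fu [d d0 dP]; exists d => // r s xr rs sy.
by apply: dP => //; [exact: le_trans xr|exact: le_trans yy].
Qed.

(* Telescoping over the partition of [x, y] into equal cells. *)
Lemma mesh_le (R : realType) (f g : R -> R) (x y : R) : x <= y ->
  (forall e, 0 < e -> exists2 d, 0 < d & forall r s, x <= r -> r <= s ->
     s <= y -> s - r <= d -> f s - f r <= e * (g s - g r)) ->
  f y <= f x.
Proof.
move=> xy H; rewrite -subr_le0; apply/ler_addgt0Pl => e e0; rewrite addr0.
(* The summand 1 keeps [C] positive when [g] takes the same value at both ends. *)
pose C := `|g y - g x| + 1.
have C0 : 0 < C by rewrite /C ltr_wpDl.
have [d d0 dP] := H (e / C) (divr_gt0 e0 C0).
pose N := (Num.truncn ((y - x) / d)).+1.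
have N0 : 0 < N%:R :> R by rewrite ltr0n.
have yxN : (y - x) / N%:R <= d.
  have : (y - x) / d < N%:R.
    have dge0 : 0 <= (y - x) / d by rewrite divr_ge0 ?subr_ge0// ltW.
    by have /andP[] := truncn_itv dge0.
  by rewrite ltr_pdivrMr// => /ltW; rewrite ler_pdivrMr// mulrC.
pose p i : R := x + i%:R * ((y - x) / N%:R).
have key (i : nat) : (i <= N)%N -> f (p i) - f x <= e / C * (g (p i) - g x).
  elim: i => [|i IH] iN; first by rewrite /p mul0r addr0 !subrr mulr0.
  have yx0 : 0 <= (y - x) / N%:R by rewrite divr_ge0 ?subr_ge0// ltW.
  have step : f (p i.+1) - f (p i) <= e / C * (g (p i.+1) - g (p i)).
    apply: dP.
    - by rewrite /p lerDl mulr_ge0.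
    - by rewrite /p lerD2l ler_wpM2r// ler_nat.
    - rewrite /p -lerBrDl -[leRHS](mulfVK (lt0r_neq0 N0)) mulrC.
      by apply: ler_wpM2l => //; rewrite ler_nat.
    - by rewrite /p opprD addrACA subrr add0r -mulrBl -natrB// subSnn mul1r.
  have := IH (ltnW iN); lra.
have := key N (leqnn _).
have -> : p N = y by rewrite /p mulrC mulfVK ?lt0r_neq0// subrKC.
move=> /le_trans; apply.
rewrite mulrAC ler_pdivrMr// ler_pM2l//.
by rewrite /C (le_trans (ler_norm _))// lerDl.
Qed.

Section ultralimit.
Variables (R : realType) (U : set_system nat).
Hypothesis UU : UltraFilter U.

Lemma ultra_cvg (u : nat -> R) (l h : R) :
  (forall n, l <= u n <= h) -> exists2 c, l <= c <= h & u n @[n --> U] --> c.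
Proof.
(* [A] collects the levels below [u n] for [U]-most [n]. Its supremum is the limit: a level outside
   [A] fails on a set of [U], because [U] decides every set. *)
move=> ulh; pose A := [set y | U [set n | y <= u n]].
have Al : A l by rewrite /A /=; apply: filterS filterT => n _ /=; have /andP[] := ulh n.
have Ah : ubound A h.
  move=> y /= /filter_ex[n /= yu]; apply: le_trans yu _.
  by have /andP[] := ulh n.
have hs : has_sup A by split; [exists l|exists h].
exists (sup A).
  apply/andP; split; first exact: ub_le_sup (proj2 hs) _ Al.
  by apply: ge_sup => //; exists l.
apply/cvgrPdist_le => e e0.
have [y Ay ye] := sup_adherent e0 hs.
have nA : ~ A (sup A + e).
  by move=> /(ub_le_sup (proj2 hs)); rewrite gerDl leNgt e0.
have [//|UC] := in_ultra_setVsetC [set n | sup A + e <= u n] UU.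
near=> n.
have H1 : ~ (sup A + e <= u n) by near: n; exact: UC.
have H2 : y <= u n by near: n; exact: Ay.
move/negP: H1; rewrite -ltNge => H1.
by rewrite ler_norml; apply/andP; split; lra.
Unshelve. all: by end_near. Qed.

End ultralimit.

(** * The scalar system and its uniqueness *)
(* [J t x] stands for the oriented integral of [Fc (t - u) * lam u] over [0, x],
   with [E] the primitive of [lam], and [zeta t] for the amount of initial fluid
   still in service at time [t]. *)
Record model_data (R : realType) (E : R -> R) (J : R -> R -> R)
    (Fc G zeta : R -> R) (L w0 : R) : Prop := ModelData {
  md_E : {homo E : x y / x <= y};
  md_Ec : continuous E;
  md_Fc : {homo Fc : x y / x <= y >-> y <= x};
  md_Fc0 : forall x, 0 <= Fc x;
  md_Fc1 : forall x, Fc x <= 1;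
  md_Fc_neg : forall x, x < 0 -> 0 < Fc x;
  md_FcL : forall x y, x <= y -> Fc x - Fc y <= L * (y - x);
  md_Jge : forall t x y, x <= y -> Fc (t - x) * (E y - E x) <= J t y - J t x;
  md_Jle : forall t x y, x <= y -> J t y - J t x <= Fc (t - y) * (E y - E x);
  md_Jt : forall t t' x y, t <= t' -> x <= y ->
    J t' y - J t' x <= J t y - J t x <= J t' y - J t' x + L * (t' - t) * (E y - E x);
  md_J0 : forall t, J t 0 = 0;
  md_L : 0 <= L;
  md_G : {homo G : x y / x <= y};
  md_Gc : continuous G;
  md_G0 : forall x, x <= 0 -> G x = 0;
  md_G1 : forall x, G x <= 1;
  md_z : {homo zeta : x y / x <= y >-> y <= x};
  md_zc : continuous zeta;
  md_w0 : 0 <= w0;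
  md_z1 : zeta 0 <= 1;
  md_zQ : J 0 0 - J 0 (- w0) = 0 \/ zeta 0 = 1;
  md_can : forall x, - w0 <= x -> x <= 0 -> J 0 x <= J 0 (- w0) -> x <= - w0
}.

(* [a t] is the arrival time of the fluid at the head of the buffer,
   [K t] the amount of fluid that entered service in ]0, t], and
   [c s t] the integral of G (t - r) over ]0, s] against dK r. *)
Record scalar_solution (R : realType) (E : R -> R) (J : R -> R -> R)
    (G zeta : R -> R) (w0 : R) (a Q K Z : R -> R) (c : R -> R -> R)
    : Prop := ScalarSolution {
  ss_a : forall t, 0 <= t -> - w0 <= a t <= t;
  ss_Q : forall t, 0 <= t -> Q t = J t t - J t (a t);
  ss_can : forall t x, 0 <= t -> - w0 <= x -> x <= t ->
    Q t <= J t t - J t x -> x <= a t;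
  ss_mono : forall s t, 0 <= s -> s <= t -> a s <= a t;
  ss_Kge : forall s t, 0 <= s -> s <= t -> J t (a t) - J t (a s) <= K t - K s;
  ss_Kle : forall s t, 0 <= s -> s <= t -> K t - K s <= J s (a t) - J s (a s);
  ss_K0 : K 0 = 0;
  ss_KZ : forall t, 0 <= t -> K t = Z t - zeta t + c t t;
  ss_c0 : forall t, 0 <= t -> c 0 t = 0;
  ss_cge : forall s s' t, 0 <= s -> s <= s' -> s' <= t ->
    G (t - s') * (K s' - K s) <= c s' t - c s t;
  ss_cle : forall s s' t, 0 <= s -> s <= s' -> s' <= t ->
    c s' t - c s t <= G (t - s) * (K s' - K s);
  ss_Z1 : forall t, 0 <= t -> Z t <= 1;
  ss_QZ : forall t, 0 <= t -> Q t = 0 \/ Z t = 1;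
  ss_a0 : a 0 = - w0
}.

Section uniqueness.
Variables (R : realType) (E : R -> R) (J : R -> R -> R).
Variables (Fc G zeta : R -> R) (L w0 : R).
Hypothesis M : model_data E J Fc G zeta L w0.

Lemma J_homo t : {homo J t : x y / x <= y}.
Proof.
move=> x y xy; rewrite -subr_ge0; apply: le_trans (md_Jge M t xy).
by rewrite mulr_ge0 ?(md_Fc0 M)// subr_ge0 (md_E M).
Qed.

Lemma J_le_E t x y : x <= y -> J t y - J t x <= E y - E x.
Proof.
move=> xy; apply: le_trans (md_Jle M t xy) _.
by rewrite ler_piMl ?(md_Fc1 M)// subr_ge0 (md_E M).
Qed.

Lemma G_ge0 x : 0 <= G x.
Proof.
have [x0|x0] := leP x 0; first by rewrite (md_G0 M).
by rewrite -(md_G0 M (lexx 0)) (md_G M)// ltW.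
Qed.

Lemma ss_homo_K a Q K Z c : scalar_solution E J G zeta w0 a Q K Z c ->
  forall s t, 0 <= s -> s <= t -> K s <= K t.
Proof.
move=> S s t s0 st; rewrite -subr_ge0; apply: le_trans (ss_Kge S s0 st).
by rewrite subr_ge0 J_homo// (ss_mono S).
Qed.

Lemma ss_Q_ge0 a Q K Z c : scalar_solution E J G zeta w0 a Q K Z c ->
  forall t, 0 <= t -> 0 <= Q t.
Proof.
move=> S t t0; rewrite (ss_Q S)// subr_ge0 J_homo//.
by have /andP[] := ss_a S t0.
Qed.

(** Integration by parts: [c r t - G (t - r) * K r] changes by the integral of [K] against the
    decrease of [r |-> G (t - r)], so an upper bound [m] on [K1 - K2] is enough and no bound on the
    variation of [K1 - K2] is required. The cell error is the oscillation of [G] times the increment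
    of [K2]. *)
Lemma conv_compare a1 Q1 K1 Z1 c1 a2 Q2 K2 Z2 c2 x y t m :
  scalar_solution E J G zeta w0 a1 Q1 K1 Z1 c1 ->
  scalar_solution E J G zeta w0 a2 Q2 K2 Z2 c2 ->
  0 <= x -> x <= y -> y <= t ->
  (forall r, x <= r -> r <= y -> K1 r - K2 r <= m) ->
  c1 y t - c2 y t - G (t - y) * (K1 y - K2 y) + m * G (t - y) <=
  c1 x t - c2 x t - G (t - x) * (K1 x - K2 x) + m * G (t - x).
Proof.
move=> S1 S2 x0 xy yt km.
pose f r := c1 r t - c2 r t - G (t - r) * (K1 r - K2 r) + m * G (t - r).
apply: (@mesh_le R f K2 x y xy) => e e0.
have [d d0 dP] := @continuous_unif_cont_on R G 0 t (md_Gc M) e e0.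
exists d => // r s xr rs sy srd.
have r0 : 0 <= r by apply: le_trans xr.
have st : s <= t by apply: le_trans yt.
have K2rs := ss_homo_K S2 r0 rs.
have c1le := ss_cle S1 r0 rs st.
have c2ge := ss_cge S2 r0 rs st.
have ks := km s (le_trans xr rs) sy.
have Grs : G (t - s) <= G (t - r) by apply: (md_G M); rewrite lerB.
have Ge : G (t - r) - G (t - s) <= e.
  apply: le_trans (ler_norm _) _; apply: dP.
  - by rewrite subr_ge0.
  - by rewrite lerB.
  - by rewrite gerBl.
  - by rewrite opprB addrC addrA subrK.
rewrite /f.
have H1 : (G (t - r) - G (t - s)) * (K1 s - K2 s - m) <= 0.
  by apply: mulr_ge0_le0; rewrite ?subr_ge0 ?subr_le0.
have H2 : (G (t - r) - G (t - s)) * (K2 s - K2 r) <= e * (K2 s - K2 r).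
  by apply: ler_wpM2r; rewrite ?subr_ge0.
move: c1le c2ge H1 H2; move: (G (t - r)) (G (t - s)) => g h.
move=> H1 H2 H3 H4; lra.
Qed.

(* While the first system holds more fluid than the second, its buffer reaches
   further back in time, [a1 s <= a2 s], so it loses more by abandonment. *)
Lemma mass_compare a1 Q1 K1 Z1 c1 a2 Q2 K2 Z2 c2 T m :
  scalar_solution E J G zeta w0 a1 Q1 K1 Z1 c1 ->
  scalar_solution E J G zeta w0 a2 Q2 K2 Z2 c2 ->
  0 <= T -> (forall t, 0 <= t -> t <= T -> `|c1 t t - c2 t t| <= m) ->
  Q1 T + Z1 T - (Q2 T + Z2 T) <= 2 * m.
Proof.
move=> S1 S2 T0 dm.
(* With entered fluid in place of fluid in service, and with equal arrivals, [P] changes only by the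
   difference of the abandonments. *)
pose P t := Q1 t - Q2 t + (K1 t - K2 t).
have PE t : 0 <= t ->
    P t = Q1 t + Z1 t - (Q2 t + Z2 t) + (c1 t t - c2 t t).
  by move=> t0; rewrite /P (ss_KZ S1 t0) (ss_KZ S2 t0); ring.
(* Truncation at [m] disposes of the times at which the first system holds no more fluid than the
   second: there [P <= m] by [PE]. *)
have : Num.max (P T) m <= Num.max (P 0) m.
  apply: (@mesh_le R (fun t => Num.max (P t) m) (fun t => E (a2 t)) 0 T T0).
  move=> e e0; exists (e / (L + 1)).
    by rewrite divr_gt0// ltr_wpDl// (md_L M).
  move=> r s r0 rs sT srd.
  have s0 : 0 <= s by apply: le_trans rs.
  have B2 : 0 <= E (a2 s) - E (a2 r).
    by rewrite subr_ge0 (md_E M)// (ss_mono S2).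
  have eB : 0 <= e * (E (a2 s) - E (a2 r)) by rewrite mulr_ge0// ltW.
  have Lse : L * (s - r) <= e.
    have L1 : 0 < L + 1 by rewrite ltr_wpDl// (md_L M).
    move: srd; rewrite ler_pdivlMr// => srd.
    have := md_L M; nra.
  have [X12|X12] := leP (Q1 s + Z1 s) (Q2 s + Z2 s).
    have Psm : P s <= m.
      have := dm s s0 sT; rewrite PE// => /ler_normlP[_]; lra.
    have : m <= Num.max (P r) m by rewrite le_max lexx orbT.
    rewrite (max_idPr Psm); lra.
  (* Otherwise the second queue is nonempty, so its servers are full and it would hold more fluid in
     total. *)
  have Q12 : Q2 s <= Q1 s.
    rewrite leNgt; apply/negP => Q12.
    have := ss_Q_ge0 S1 s0; have := ss_Z1 S1 s0.
    have [] := ss_QZ S2 s0; lra.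
  have a12 : a1 s <= a2 s.
    have /andP[? ?] := ss_a S1 s0.
    by apply: (ss_can S2 s0) => //; rewrite -(ss_Q S1).
  (* Up to a term common to both systems, [J r x - J s x] is minus the fluid arrived after [x] that
     loses patience over [[r, s]]. [J1] compares it at [a1 s] and [a2 s]; [J2] moves from [a2 s] to
     [a2 r] at Lipschitz cost. *)
  have PP : P s - P r <= e * (E (a2 s) - E (a2 r)).
    have /andP[J1 _] := md_Jt M rs a12.
    have /andP[_ J2] := md_Jt M rs (ss_mono S2 r0 rs).
    have K1' := ss_Kle S1 r0 rs.
    have K2' := ss_Kge S2 r0 rs.
    have : L * (s - r) * (E (a2 s) - E (a2 r)) <= e * (E (a2 s) - E (a2 r)).
      by apply: ler_wpM2r.
    rewrite /P (ss_Q S1 s0) (ss_Q S1 r0) (ss_Q S2 s0) (ss_Q S2 r0); lra.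
  have [Pm|mP] := leP (P s) m.
    have : m <= Num.max (P r) m by rewrite le_max lexx orbT.
    lra.
  have : P r <= Num.max (P r) m by rewrite le_max lexx.
  lra.
have m0 : 0 <= m by apply: le_trans (dm 0 (lexx _) T0).
have -> : P 0 = 0.
  rewrite /P (ss_Q S1 (lexx 0)) (ss_Q S2 (lexx 0)) (ss_a0 S1) (ss_a0 S2).
  by rewrite (ss_K0 S1) (ss_K0 S2); ring.
rewrite (max_idPr m0) ge_max lexx andbT PE// => H.
by have := dm T T0 (lexx _) => /ler_normlP[]; lra.
Qed.

(** If the second servers are full, [Z1 <= Z2] and only the convolutions contribute, at most [m]. If
    the second queue is empty, [Z1 - Z2] is at most the mass difference, which adds [2 * m]. *)
Lemma service_compare a1 Q1 K1 Z1 c1 a2 Q2 K2 Z2 c2 T m :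
  scalar_solution E J G zeta w0 a1 Q1 K1 Z1 c1 ->
  scalar_solution E J G zeta w0 a2 Q2 K2 Z2 c2 ->
  0 <= T -> (forall t, 0 <= t -> t <= T -> `|c1 t t - c2 t t| <= m) ->
  K1 T - K2 T <= 3 * m.
Proof.
move=> S1 S2 T0 dm.
have X12 := mass_compare S1 S2 T0 dm.
have /ler_normlP[_ d12] := dm T T0 (lexx _).
have m0 : 0 <= m by apply: le_trans (dm 0 (lexx _) T0).
rewrite (ss_KZ S1 T0) (ss_KZ S2 T0).
have := ss_Z1 S1 T0; have := ss_Q_ge0 S1 T0.
have [] := ss_QZ S2 T0; lra.
Qed.

(** Equality of the queues is enough: through [Fd_inv] it determines the waiting times, and these
    determine both measures. *)
Lemma scalar_solution_unique a1 Q1 K1 Z1 c1 a2 Q2 K2 Z2 c2 :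
  scalar_solution E J G zeta w0 a1 Q1 K1 Z1 c1 ->
  scalar_solution E J G zeta w0 a2 Q2 K2 Z2 c2 ->
  forall t, 0 <= t -> Q1 t = Q2 t.
Proof.
move=> S1 S2.
(* [service_compare] multiplies the convolution error by 3, so the bound 1/6 yields a contraction by
   one half. *)
have [tau tau0 Gtau] : exists2 tau, 0 < tau & G tau <= 6^-1.
  have e0 : 0 < 6^-1 :> R by rewrite invr_gt0.
  have [d d0 dP] := @continuous_unif_cont_on R G 0 1 (md_Gc M) _ e0.
  exists (Num.min d 1); first by rewrite lt_min d0 ltr01.
  have q0 : 0 <= Num.min d 1 by rewrite le_min (ltW d0) ler01.
  have q1 : Num.min d 1 <= 1 by rewrite ge_min lexx orbT.
  have qd : Num.min d 1 - 0 <= d by rewrite subr0 ge_min lexx.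
  apply: le_trans (dP 0 _ (lexx 0) q0 q1 qd).
  by rewrite (md_G0 M (lexx 0)) subr0 ler_norm.
(* Up to [x] the entries agree, and [conv_compare] with bound 0 gives no contribution; the interval
   from [x] to [t] contributes at most [m * G (t - x)]. *)
have dcomp (x t m : R) : 0 <= x -> x <= t ->
    (forall r, 0 <= r -> r <= x -> K1 r = K2 r) ->
    (forall r, x <= r -> r <= t -> `|K1 r - K2 r| <= m) ->
    `|c1 t t - c2 t t| <= m * G (t - x).
  move=> x0 xt k0 km.
  have k0' r : 0 <= r -> r <= x -> K1 r - K2 r <= 0.
    by move=> ? ?; rewrite k0// subrr.
  have k0'' r : 0 <= r -> r <= x -> K2 r - K1 r <= 0.
    by move=> ? ?; rewrite k0// subrr.
  have A1 := conv_compare S1 S2 (lexx 0) x0 xt k0'.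
  have A2 := conv_compare S2 S1 (lexx 0) x0 xt k0''.
  have t0 := le_trans x0 xt.
  have B1 : c1 t t - c2 t t - G (t - t) * (K1 t - K2 t) + m * G (t - t) <=
      c1 x t - c2 x t - G (t - x) * (K1 x - K2 x) + m * G (t - x).
    apply: (conv_compare S1 S2) => // r xr rt.
    exact: le_trans (ler_norm _) (km r xr rt).
  have B2 : c2 t t - c1 t t - G (t - t) * (K2 t - K1 t) + m * G (t - t) <=
      c2 x t - c1 x t - G (t - x) * (K2 x - K1 x) + m * G (t - x).
    apply: (conv_compare S2 S1) => // r xr rt.
    by have := km r xr rt; rewrite ler_norml => /andP[]; lra.
  move: A1 A2 B1 B2; rewrite (ss_K0 S1) (ss_K0 S2) (k0 x)// !subrr.
  rewrite (md_G0 M (lexx 0)) (ss_c0 S1)// (ss_c0 S2)//.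
  by move=> *; rewrite ler_norml; apply/andP; split; lra.
have main (n : nat) : forall t, 0 <= t -> t <= n%:R * tau -> K1 t = K2 t.
  elim: n => [|n IH] t t0 tn.
    have -> : t = 0 by apply/eqP; rewrite eq_le t0 andbT; move: tn; rewrite mul0r.
    by rewrite (ss_K0 S1) (ss_K0 S2).
  pose t1 := n%:R * tau; pose T := n.+1%:R * tau.
  have t10 : 0 <= t1 by rewrite mulr_ge0// ltW.
  have T0 : 0 <= T by rewrite mulr_ge0// ltW.
  have Tt1 : T - t1 = tau by rewrite -mulrBl -natrB// subSnn mul1r.
  (* The supremum over all of [[0, T]] is finite because [K1] and [K2] are nondecreasing; the part
     up to [t1] contributes 0. *)
  pose A := [set `|K1 r - K2 r| | r in [set r | 0 <= r <= T]].
  have A0 : A 0 by exists 0; rewrite /= ?lexx// (ss_K0 S1) (ss_K0 S2) subrr normr0.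
  have Aub : ubound A (K1 T + K2 T).
    move=> _ [r /andP[r0 rT] <-].
    have H1 := ss_homo_K S1 r0 rT; have H2 := ss_homo_K S2 r0 rT.
    have := ss_homo_K S1 (lexx 0) r0; have := ss_homo_K S2 (lexx 0) r0.
    by rewrite (ss_K0 S1) (ss_K0 S2) ler_norml => *; apply/andP; split; lra.
  have hs : has_sup A by split; [exists 0|exists (K1 T + K2 T)].
  have Am r : 0 <= r -> r <= T -> `|K1 r - K2 r| <= sup A.
    by move=> r0 rT; apply: (ub_le_sup (proj2 hs)); exists r; rewrite //= r0.
  have m0 : 0 <= sup A by apply: le_trans (Am 0 _ _).
  have dm r : 0 <= r -> r <= T -> `|c1 r r - c2 r r| <= sup A / 6.
    move=> r0 rT; have [rt1|t1r] := leP r t1.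
      apply: (@le_trans _ _ (0 * G (r - r))); last by rewrite mul0r divr_ge0.
      apply: dcomp => // q => [q0 qr|rq qr].
        by apply: IH => //; apply: le_trans rt1.
      by rewrite (IH q) ?subrr ?normr0// ?(le_trans r0)// (le_trans qr).
    apply: (@le_trans _ _ (sup A * G (r - t1))).
      apply: dcomp => //; first exact: ltW.
      by move=> q t1q qr; apply: Am; [exact: le_trans t1q|exact: le_trans rT].
    apply: ler_wpM2l => //; apply: le_trans Gtau; apply: (md_G M).
    by rewrite -Tt1 lerB.
  have : sup A <= 3 * (sup A / 6).
    apply: ge_sup => [|_ [r /andP[r0 rT] <-]]; first by exists 0.
    have dm' q : 0 <= q -> q <= r -> `|c1 q q - c2 q q| <= sup A / 6.
      by move=> q0 qr; apply: dm => //; apply: le_trans rT.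
    have dm'' q : 0 <= q -> q <= r -> `|c2 q q - c1 q q| <= sup A / 6.
      by move=> q0 qr; rewrite distrC; apply: dm'.
    have C1 := service_compare S1 S2 r0 dm'; have C2 := service_compare S2 S1 r0 dm''.
    by rewrite ler_norml; apply/andP; split; lra.
  move=> sA; have sA0 : sup A <= 0 by lra.
  by apply/eqP; rewrite -subr_eq0 -normr_le0; apply: le_trans sA0; exact: Am.
have KK t : 0 <= t -> K1 t = K2 t.
  move=> t0; apply: (main (Num.truncn (t / tau)).+1) => //.
  have tt : 0 <= t / tau by rewrite divr_ge0// ltW.
  by have /andP[_ /ltW] := truncn_itv tt; rewrite ler_pdivrMr.
have cc t : 0 <= t -> `|c1 t t - c2 t t| <= 0.
  move=> t0; rewrite -(mul0r (G (t - t))); apply: dcomp => // q => [q0 _|tq _].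
    exact: KK.
  by rewrite KK ?subrr ?normr0// (le_trans t0).
move=> t t0.
have H1 := mass_compare S1 S2 t0 (fun r r0 _ => cc r r0).
have H2 : Q2 t + Z2 t - (Q1 t + Z1 t) <= 2 * 0.
  by apply: (mass_compare S2 S1 t0) => r r0 _; rewrite distrC; apply: cc.
have /eqP : K1 t = K2 t by exact: KK.
rewrite (ss_KZ S1)// (ss_KZ S2)//.
have := cc t t0; rewrite normr_le0 subr_eq0 => /eqP -> /eqP.
lra.
Qed.

End uniqueness.

(** * Continuity of scalar solutions and the discrete scheme *)
Section continuity.
Variables (R : realType) (E : R -> R) (J : R -> R -> R).
Variables (Fc G zeta : R -> R) (L w0 : R).
Hypothesis M : model_data E J Fc G zeta L w0.

(** When [Z s = 1 >= Z t], entries over []s, t]] only replace completed services, so the drop of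
    [zeta] and the growth of the convolution bound them. The assumptions are listed singly because
    the lemma also serves to exclude jumps of [B] in a fluid solution, before the inequalities
    between [K] and [J] are known for it. *)
Lemma service_modulus (K Z : R -> R) (c : R -> R -> R) (T : R) :
  (forall s t, 0 <= s -> s <= t -> K s <= K t) -> K 0 = 0 ->
  (forall t, 0 <= t -> K t = Z t - zeta t + c t t) ->
  (forall t, 0 <= t -> c 0 t = 0) ->
  (forall s s' t, 0 <= s -> s <= s' -> s' <= t ->
    G (t - s') * (K s' - K s) <= c s' t - c s t) ->
  (forall s s' t, 0 <= s -> s <= s' -> s' <= t ->
    c s' t - c s t <= G (t - s) * (K s' - K s)) ->
  (forall t, 0 <= t -> Z t <= 1) ->
  forall e, 0 < e -> exists2 d, 0 < d & forall s t, 0 <= s -> s <= t ->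
    t <= T -> t - s <= d -> Z s = 1 -> K t - K s <= e.
Proof.
move=> Km K0 KZ c0 cge cle Z1 e e0.
have [T0|T0] := ltP T 0.
  exists 1 => // s t s0 st tT; exfalso; move: T0.
  by rewrite ltNge => /negP; apply; apply: le_trans tT; apply: le_trans st.
have KT0 : 0 <= K T by rewrite -K0 Km.
(* The budget is [e1] for [zeta], [e1 * K T] for moving the horizon of the convolution from [s] to
   [t], and [e1 * K T] for the entries after [s], which count with weight at most [G (t - s)]. *)
pose e1 := e / (3 * (K T + 1)).
have e10 : 0 < e1 by rewrite divr_gt0// mulr_gt0// ltr_wpDl.
have e1K : e1 * K T + e1 * K T + e1 <= e.
  have : e = e1 * (3 * (K T + 1)).
    by rewrite /e1 mulfVK// lt0r_neq0// mulr_gt0// ltr_wpDl.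
  have : 0 <= e1 * K T by rewrite mulr_ge0// ltW.
  nra.
have [d1 d10 dG] := @continuous_unif_cont_on R G 0 T (md_Gc M) e1 e10.
have [d2 d20 dz] := @continuous_unif_cont_on R zeta 0 T (md_zc M) e1 e10.
exists (Num.min d1 d2) => [|s t s0 st tT]; first by rewrite lt_min d10.
rewrite le_min => /andP[tsd1 tsd2] Zs.
have t0 := le_trans s0 st.
have sT := le_trans st tT.
have Gd r : 0 <= r -> r <= s -> G (t - r) - G (s - r) <= e1.
  move=> r0 rs; apply: le_trans (ler_norm _) _; apply: dG.
  - by rewrite subr_ge0.
  - by rewrite lerB.
  - by rewrite lerBlDr ler_wpDr.
  - by rewrite opprB addrA subrK.
have Kst := Km s t s0 st.
have Ks0 : 0 <= K s by rewrite -K0 Km.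
have KsT : K s <= K T by exact: Km.
have KtT : K t <= K T by exact: Km.
have C1 : c s t - c s s <= e1 * K T.
  suff : c s t - c s s - e1 * K s <= 0.
    by have : e1 * K s <= e1 * K T; [apply: ler_wpM2l => //; exact: ltW|lra].
  have -> : 0 = c 0 t - c 0 s - e1 * K 0 by rewrite c0// c0// K0; ring.
  apply: (@mesh_le R (fun r => c r t - c r s - e1 * K r) K 0 s s0) => e2 e20.
  have [d d0 dP] := @continuous_unif_cont_on R G 0 T (md_Gc M) e2 e20.
  exists d => // r r' r0 rr' r's r'rd.
  have H1 := cle r r' t r0 rr' (le_trans r's st).
  have H2 := cge r r' s r0 rr' r's.
  have H3 := Gd r r0 (le_trans rr' r's).
  have H4 : G (s - r) - G (s - r') <= e2.
    apply: le_trans (ler_norm _) _; apply: dP.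
    - by rewrite subr_ge0.
    - by rewrite lerB.
    - by rewrite lerBlDr ler_wpDr.
    - by rewrite opprB addrC addrA subrK.
  have H5 : 0 <= K r' - K r by rewrite subr_ge0 Km.
  have : (G (t - r) - G (s - r')) * (K r' - K r) <= (e1 + e2) * (K r' - K r).
    by apply: ler_wpM2r => //; lra.
  lra.
have C2 : c t t - c s t <= e1 * K T.
  apply: le_trans (cle s t t s0 st (lexx _)) _.
  apply: (@le_trans _ _ (e1 * (K t - K s))).
    apply: ler_wpM2r; first by rewrite subr_ge0.
    have := Gd s s0 (lexx s); rewrite subrr (md_G0 M (lexx 0)); lra.
  by apply: ler_wpM2l; [exact: ltW|lra].
have C3 : zeta s - zeta t <= e1.
  by rewrite -opprB lerNl; have := dz s t s0 st tT tsd2 => /ler_normlP[]; lra.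
have := Z1 t t0; rewrite (KZ t)// (KZ s)// Zs; lra.
Qed.

(** All fluid that arrived up to [t - x] has lost patience, so [J t] is flat there, and a maximal
    position cannot lie to the left of the end of the flat part. *)
Lemma canonical_ge (t x b : R) : 0 <= x -> Fc x = 0 -> - w0 <= b ->
  (forall y, - w0 <= y -> y <= t -> J t y <= J t b -> y <= b) -> t - x <= b.
Proof.
move=> x0 Fx wb can.
have [tw|wt] := leP (t - x) (- w0); first exact: le_trans wb.
have [bxt|/ltW//] := leP b (t - x).
apply: can; rewrite ?gerBl ?(ltW wt)// -subr_le0.
by apply: le_trans (md_Jle M t bxt) _; rewrite subKr Fx mul0r.
Qed.

Section solution.
Variables (a Q K Z : R -> R) (c : R -> R -> R).
Hypothesis S : scalar_solution E J G zeta w0 a Q K Z c.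

Lemma head_ge x t : 0 <= x -> Fc x = 0 -> 0 <= t -> t - x <= a t.
Proof.
move=> x0 Fx t0; have /andP[at0 _] := ss_a S t0.
apply: canonical_ge => // y wy yt Jy; apply: (ss_can S t0) => //.
by rewrite (ss_Q S)// lerD2l lerN2.
Qed.

Lemma head_eq t : 0 <= t -> Q t = 0 -> a t = t.
Proof.
move=> t0 Qt; have /andP[at0 att] := ss_a S t0.
apply: le_anti; rewrite att/=; apply: (ss_can S t0) => //.
  by rewrite (le_trans at0).
by rewrite Qt subrr.
Qed.

(** If the servers are full at [s], [service_modulus] applies. If the queue is empty, [a s = s] and
    the entries over []s, t]] are bounded by the arrivals. *)
Lemma service_unif_cont T : unif_cont_on K 0 T.
Proof.
move=> e e0.
have [d1 d10 dK] := service_modulus T (ss_homo_K M S) (ss_K0 S) (ss_KZ S)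
  (ss_c0 S) (ss_cge S) (ss_cle S) (ss_Z1 S) e0.
have [d2 d20 dE] := @continuous_unif_cont_on R E 0 T (md_Ec M) e e0.
exists (Num.min d1 d2) => [|s t s0 st tT]; first by rewrite lt_min d10.
rewrite le_min => /andP[tsd1 tsd2].
have Kst := ss_homo_K M S s0 st.
rewrite ger0_norm ?subr_ge0//.
have [Qs|Zs] := ss_QZ S s0; last exact: dK.
have as_ := head_eq s0 Qs.
have t0 := le_trans s0 st.
apply: le_trans (ss_Kle S s0 st) _.
apply: le_trans (J_le_E M _ (ss_mono S s0 st)) _.
have /andP[_ att] := ss_a S t0.
rewrite as_; apply: (@le_trans _ _ (E t - E s)).
  by rewrite lerD2r (md_E M).
by apply: le_trans (ler_norm _) _; apply: dE.
Qed.

(* If [E \o a] grew by [e] over a short interval, fluid of amount [e / 2] would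
   have left the buffer while its waiting time was still well below the end of
   the support of [F], which forces [K] to grow by a fixed amount. *)
Lemma departure_unif_cont T : 0 <= T -> unif_cont_on (E \o a) 0 T.
Proof.
move=> T0 e e0 /=.
have e20 : 0 < e / 2 by rewrite divr_gt0.
have [rho rho0 dE] := @continuous_unif_cont_on R E (- w0) T (md_Ec M) _ e20.
pose A := [set t - a t | t in [set t | 0 <= t <= T]].
have Aub : ubound A (T + w0).
  move=> _ [t /andP[t0 tT] <-]; have /andP[] := ss_a S t0; lra.
have A0 : A (0 - a 0) by exists 0; rewrite //= lexx.
have hs : has_sup A by split; [exists (0 - a 0)|exists (T + w0)].
pose y := sup A.
have yA t : 0 <= t -> t <= T -> t - a t <= y.
  by move=> t0 tT; apply: (ub_le_sup (proj2 hs)); exists t; rewrite //= t0.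
(* [y] is the supremum of the waits. If [y - rho / 2] were a nonnegative zero of [Fc], [head_ge]
   would bound all waits by this smaller number. Fluid arrived after [a s + rho] has age at most
   [y - rho / 2] at time [t], since [t - s <= rho / 2]. *)
pose p := Fc (y - rho / 2).
have p0 : 0 < p.
  have [y0|y0] := ltP (y - rho / 2) 0; first exact: md_Fc_neg M _ y0.
  rewrite lt_neqAle (md_Fc0 M) andbT; apply/eqP => /esym Fy.
  have : y <= y - rho / 2.
    apply: ge_sup => [|_ [t /andP[t0 tT] <-]]; first by exists (0 - a 0).
    by have := head_ge y0 Fy t0; lra.
  lra.
have pe0 : 0 < p * (e / 4) by rewrite mulr_gt0// divr_gt0.
have [d1 d10 dK] := @service_unif_cont T _ pe0.
exists (Num.min d1 (rho / 2)) => [|s t s0 st tT].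
  by rewrite lt_min d10 divr_gt0.
rewrite le_min => /andP[tsd1 tsrho].
have t0 := le_trans s0 st.
have ast := ss_mono S s0 st.
have /andP[aw _] := ss_a S s0.
have /andP[_ at_] := ss_a S t0.
rewrite ger0_norm ?subr_ge0 ?(md_E M)// leNgt; apply/negP => Be.
have [u0at|] := ltP (a s + rho) (a t); last first.
  move=> H; have atas : a t - a s <= rho by lra.
  have := dE _ _ aw ast (le_trans at_ tT) atas => /ler_normlP[_]; lra.
have u0T : a s + rho <= T by rewrite (le_trans (ltW u0at))// (le_trans at_).
have asu0 : a s <= a s + rho by rewrite lerDl ltW.
have u0d : a s + rho - a s <= rho by rewrite addrC addKr.
have := dE _ _ aw asu0 u0T u0d => /ler_normlP[_] Eu0.
have H1 := md_Jge M t (ltW u0at).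
have H2 := J_homo M t asu0.
have H3 := ss_Kge S s0 st.
have := dK s t s0 st tT tsd1 => /ler_normlP[_] H4.
have pF : p <= Fc (t - (a s + rho)).
  by apply: (md_Fc M); have := yA s s0 (le_trans st tT); lra.
have : p * (e / 2) <= Fc (t - (a s + rho)) * (E (a t) - E (a s + rho)).
  by apply: ler_pM => //; [exact: ltW|exact: ltW|lra].
have : 0 < p * e by rewrite mulr_gt0.
lra.
Qed.

End solution.
End continuity.

Section scheme.
Variables (R : realType) (E : R -> R) (J : R -> R -> R).
Variables (Fc G zeta : R -> R) (L w0 : R).
Hypothesis M : model_data E J Fc G zeta L w0.

(** Arrival-time counterpart of [Fd_inv]: the infimum of waiting times becomes a supremum of head
    positions. *)
Definition frontier (t q : R) : R :=
  sup [set x | - w0 <= x <= t /\ q <= J t t - J t x].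

Lemma frontierP t q : 0 <= t -> 0 <= q -> q <= J t t - J t (- w0) ->
  [/\ - w0 <= frontier t q <= t, J t t - J t (frontier t q) = q &
      forall x, - w0 <= x -> x <= t -> q <= J t t - J t x -> x <= frontier t q].
Proof.
move=> t0 q0 qJ; pose A := [set x | - w0 <= x <= t /\ q <= J t t - J t x].
have wt : - w0 <= t by apply: le_trans t0; rewrite oppr_le0 (md_w0 M).
have Aw : A (- w0) by rewrite /A /= lexx wt.
have At : ubound A t by move=> x [/andP[]].
have hs : has_sup A by split; [exists (- w0)|exists t].
have can x : - w0 <= x -> x <= t -> q <= J t t - J t x -> x <= sup A.
  by move=> wx xt qx; apply: (ub_le_sup (proj2 hs)); split => //; rewrite wx.
have wA : - w0 <= sup A by exact: ub_le_sup (proj2 hs) _ Aw.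
have sAt : sup A <= t by apply: ge_sup => //; exists (- w0).
have Enear e : 0 < e -> exists2 d, 0 < d &
    forall x, `|x - sup A| < d -> `|E x - E (sup A)| < e.
  move=> e0; have cE : continuous E := md_Ec M.
  have /cvgrPdist_lt/(_ e e0)[d d0 dP] := cE (sup A).
  by exists d => // x xd; rewrite distrC; apply: dP; rewrite /= distrC.
split => //; first by rewrite /frontier wA.
apply/le_anti/andP; split; last first.
  rewrite -subr_le0; apply/ler_addgt0Pl => e e0; rewrite addr0.
  have [d d0 dE] := Enear e e0.
  have [x [/andP[wx xt] qx] xd] := sup_adherent d0 hs.
  have xs : x <= sup A by apply: can.
  have := J_le_E M t xs.
  have : `|E x - E (sup A)| < e by apply: dE; rewrite ltr_norml; apply/andP; split; lra.
  by move=> /ltr_normlP[]; rewrite /frontier -/A; lra.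
rewrite leNgt; apply/negP => qh.
have st : sup A < t.
  rewrite lt_neqAle sAt andbT; apply/eqP => sAE.
  by move: qh; rewrite /frontier -/A sAE subrr ltNge q0.
pose e := J t t - J t (sup A) - q.
have e0 : 0 < e by rewrite subr_gt0.
have [d d0 dE] := Enear e e0.
pose x := Num.min t (sup A + d / 2).
have sx : sup A < x by rewrite /x lt_min st ltrDl divr_gt0.
have xt : x <= t by rewrite /x ge_min lexx.
have xd : x <= sup A + d / 2 by rewrite /x ge_min lexx orbT.
have : x <= sup A.
  apply: can => //; first by rewrite (le_trans wA)// ltW.
  have : `|E x - E (sup A)| < e by apply: dE; rewrite ltr_norml; apply/andP; split; lra.
  have := J_le_E M t (ltW sx).
  by move=> + /ltr_normlP[_]; rewrite /e; lra.
by rewrite leNgt sx.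
Qed.

Variable h : R.
Hypothesis h0 : 0 < h.

(* [1 - zeta t - K + c t] is the service capacity that is free at time [t] if
   nobody enters service after the previous step. *)
Definition scheme_step (t : R) (x : R * R * (R -> R)) : R * R * (R -> R) :=
  let: (a, K, c) := x in
  let a' := frontier t (Num.max 0 (J t t - J t a - (1 - zeta t - K + c t))) in
  let dK := J t a' - J t a in
  (a', K + dK, fun s => c s + dK * G (s - t)).

Fixpoint scheme (k : nat) : R * R * (R -> R) :=
  if k is k'.+1 then scheme_step (k%:R * h) (scheme k')
  else (- w0, 0, fun=> 0).

Definition sch_a k := (scheme k).1.1.
Definition sch_K k := (scheme k).1.2.
Definition sch_c k := (scheme k).2.
Let grid (k : nat) : R := k%:R * h.

Lemma sch_KS k : sch_K k.+1 =
  sch_K k + (J (grid k.+1) (sch_a k.+1) - J (grid k.+1) (sch_a k)).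
Proof. by rewrite /sch_K /sch_a /=; case: (scheme k) => [[]]. Qed.

Lemma sch_cS k s : sch_c k.+1 s =
  sch_c k s + (J (grid k.+1) (sch_a k.+1) - J (grid k.+1) (sch_a k)) *
    G (s - grid k.+1).
Proof. by rewrite /sch_c /sch_a /=; case: (scheme k) => [[]]. Qed.

Lemma sch_aS k : sch_a k.+1 = frontier (grid k.+1) (Num.max 0
  (J (grid k.+1) (grid k.+1) - J (grid k.+1) (sch_a k) -
   (1 - zeta (grid k.+1) - sch_K k + sch_c k (grid k.+1)))).
Proof. by rewrite /sch_c /sch_a /sch_K /=; case: (scheme k) => [[]]. Qed.

Let grid_ge0 k : 0 <= grid k. Proof. by rewrite mulr_ge0// ltW. Qed.

Let grid_le j k : (j <= k)%N -> grid j <= grid k.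
Proof. by move=> jk; rewrite ler_wpM2r ?ler_nat// ltW. Qed.

Definition sch_Z k := zeta (grid k) + sch_K k - sch_c k (grid k).
Definition sch_Q k := J (grid k) (grid k) - J (grid k) (sch_a k).

Let inv k : Prop := [/\ - w0 <= sch_a k <= grid k,
  forall x, - w0 <= x -> x <= grid k -> sch_Q k <= J (grid k) (grid k) - J (grid k) x ->
    x <= sch_a k,
  sch_Z k <= 1, sch_Q k = 0 \/ sch_Z k = 1 &
  {homo sch_c k : x y / x <= y}].

Let invS k : inv k -> inv k.+1 /\ sch_a k <= sch_a k.+1.
Proof.
move=> [/andP[wa at_] can Z1 QZ cm].
set t := grid k.+1.
have kt : grid k <= t by apply: grid_le.
have t0 : 0 <= t by exact: grid_ge0.
pose P := J t t - J t (sch_a k).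
pose C := 1 - zeta t - sch_K k + sch_c k t.
pose q := Num.max 0 (P - C).
have aE : sch_a k.+1 = frontier t q by rewrite sch_aS.
have P0 : 0 <= P by rewrite subr_ge0 (J_homo M)// (le_trans at_).
have C0 : 0 <= C.
  have := md_z M kt; have := cm _ _ kt; move: Z1.
  rewrite /sch_Z /C; lra.
have q0 : 0 <= q by rewrite le_max lexx.
have qP : q <= P by rewrite ge_max P0 gerBl.
have qJ : q <= J t t - J t (- w0).
  by apply: le_trans qP _; rewrite lerD2l lerN2 (J_homo M).
have [/andP[wh ht] hq hcan] := frontierP t0 q0 qJ.
have QE : sch_Q k.+1 = q by rewrite /sch_Q aE.
have aa : sch_a k <= sch_a k.+1.
  by rewrite aE; apply: hcan => //; exact: le_trans kt.
have dKE : J t (sch_a k.+1) - J t (sch_a k) = P - q.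
  by move: hq; rewrite aE /P; lra.
have ZE : sch_Z k.+1 = 1 - C + (P - q).
  rewrite /sch_Z sch_KS sch_cS -/t dKE subrr (md_G0 M (lexx 0)) /C; ring.
split => //; split.
- by rewrite aE wh.
- by move=> x wx xt; rewrite QE aE; apply: hcan.
- rewrite ZE; have : P - C <= q by rewrite le_max lexx orbT.
  lra.
- rewrite QE ZE /q; have [H|H] := leP (P - C) 0; first by left.
  by right; ring.
- move=> x y xy; rewrite !sch_cS lerD ?cm// ler_wpM2l//.
    by rewrite subr_ge0 (J_homo M).
  by rewrite (md_G M)// lerB.
Qed.

Lemma sch_inv k : inv k.
Proof.
elim: k => [|k /invS[]//].
have g0 : grid 0 = 0 by rewrite /grid mul0r.
split; rewrite /sch_Q /sch_Z /sch_a /sch_K /sch_c /= ?g0.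
- by rewrite lexx oppr_le0 (md_w0 M).
- by move=> x wx x0; rewrite lerD2l lerN2; apply: (md_can M).
- by rewrite addr0 subr0 (md_z1 M).
- by rewrite addr0 subr0; apply: (md_zQ M).
- by [].
Qed.

Lemma sch_a_homo j k : (j <= k)%N -> sch_a j <= sch_a k.
Proof.
move=> /subnK <-; elim: (k - j)%N => [|n IH]//; rewrite addSn.
by apply: le_trans IH _; have [] := invS (sch_inv (n + j)).
Qed.

(** Each entry is measured by [J] at its own grid time. Increments of [J] decrease in time, so
    evaluating them all at the last or at the first grid time bounds the sum from below or above. *)
Lemma sch_K_bounds j k : (j <= k)%N ->
  J (grid k) (sch_a k) - J (grid k) (sch_a j) <= sch_K k - sch_K j <=
  J (grid j) (sch_a k) - J (grid j) (sch_a j).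
Proof.
move=> /subnK <-; elim: (k - j)%N => [|n IH]; first by rewrite add0n !subrr lexx.
rewrite addSn; set m := (n + j)%N in IH *.
have jm : (j <= m)%N by rewrite leq_addl.
have ajm := sch_a_homo jm.
have amm := sch_a_homo (leqnSn m).
have /andP[H1 _] := md_Jt M (grid_le (leqnSn m)) ajm.
have /andP[H2 _] := md_Jt M (grid_le (leq_trans jm (leqnSn m))) amm.
rewrite sch_KS; case/andP: IH => IH1 IH2; apply/andP; split; lra.
Qed.

Lemma sch_K_homo j k : (j <= k)%N -> sch_K j <= sch_K k.
Proof.
move=> jk; have /andP[+ _] := sch_K_bounds jk.
have := J_homo M (grid k) (sch_a_homo jk); lra.
Qed.

Lemma sch_c_bounds j k s : (j <= k)%N ->
  G (s - grid k) * (sch_K k - sch_K j) <= sch_c k s - sch_c j s <=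
  G (s - grid j) * (sch_K k - sch_K j).
Proof.
move=> /subnK <-; elim: (k - j)%N => [|n IH].
  by rewrite add0n !subrr !mulr0 lexx.
rewrite addSn; set m := (n + j)%N in IH *.
have jm : (j <= m)%N by rewrite leq_addl.
rewrite sch_cS sch_KS.
set dK := J _ _ - J _ _.
have dK0 : 0 <= dK by rewrite subr_ge0 (J_homo M)// sch_a_homo.
have jmK : 0 <= sch_K m - sch_K j by rewrite subr_ge0 sch_K_homo.
have g1 : G (s - grid m.+1) <= G (s - grid m).
  by apply: (md_G M); rewrite lerB// grid_le.
have g2 : G (s - grid m.+1) <= G (s - grid j).
  by apply: (md_G M); rewrite lerB// grid_le// (leq_trans jm).
have := ler_wpM2r jmK g1; have := ler_wpM2r dK0 g2.
by case/andP: IH => IH1 IH2 H1 H2; apply/andP; split; lra.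
Qed.

(** Unlike the maximality of the head, this inequality passes to the limit of the schemes. *)
Lemma sch_head_ge k x : 0 <= x -> Fc x = 0 -> grid k - x <= sch_a k.
Proof.
move=> x0 Fx; have [/andP[wa _] can _ _ _] := sch_inv k.
apply: (canonical_ge M) => // y wy yt Jy; apply: can => //.
by rewrite lerD2l lerN2.
Qed.

End scheme.

(** * Existence for the scalar system *)
Section existence.
Variables (R : realType) (E : R -> R) (J : R -> R -> R).
Variables (Fc G zeta : R -> R) (L w0 : R).
Hypothesis M : model_data E J Fc G zeta L w0.

Lemma J_time t t' x : `|J t x - J t' x| <= L * `|t - t'| * `|E x - E 0|.
Proof.
wlog tt : t t' / t <= t' => [H|].
  by have [/H//|/ltW/H] := leP t t'; rewrite distrC (distrC t').
rewrite (ler0_norm (x := t - t')) ?subr_le0// opprB.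
have [x0|/ltW x0] := leP 0 x.
  have := md_Jt M tt x0; rewrite !(md_J0 M) !subr0 => /andP[H1 H2].
  rewrite !ger0_norm ?subr_ge0//; first by rewrite lerBlDl.
  exact: md_E M _ _ x0.
have := md_Jt M tt x0; rewrite !(md_J0 M) !sub0r => /andP[H1 H2].
rewrite ler0_norm ?subr_le0; last by rewrite -lerN2.
rewrite ler0_norm ?subr_le0; last exact: md_E M _ _ x0.
lra.
Qed.

Lemma J_cvg (U : set_system nat) {FU : Filter U} (tn xn : nat -> R) t x :
  tn n @[n --> U] --> t -> xn n @[n --> U] --> x ->
  J (tn n) (xn n) @[n --> U] --> J t x.
Proof.
move=> ct cx.
have cE : continuous E := md_Ec M.
have cEx : E (xn n) @[n --> U] --> E x by apply: continuous_cvg => //; exact: cE.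
pose b n := `|E (xn n) - E x| + L * `|tn n - t| * `|E (xn n) - E 0|.
have b0 : b n @[n --> U] --> 0.
  rewrite [X in _ --> X](_ : 0 = `|E x - E x| + L * `|t - t| * `|E x - E 0|).
    apply: cvgD; first by apply: cvg_norm; apply: cvgB => //; exact: cvg_cst.
    apply: cvgM; last by apply: cvg_norm; apply: cvgB => //; exact: cvg_cst.
    apply: cvgM; first exact: cvg_cst.
    by apply: cvg_norm; apply: cvgB => //; exact: cvg_cst.
  by rewrite !subrr normr0 mulr0 mul0r addr0.
apply/cvgrPdist_le => e e0.
move/cvgrPdist_le : b0 => /(_ e e0); apply: filterS => n.
rewrite sub0r normrN; apply: le_trans.
apply: le_trans (ler_norm _).
rewrite distrC -(subrK (J t (xn n)) (J (tn n) (xn n))) -addrA addrC.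
apply: le_trans (ler_normD _ _) _; apply: lerD; last exact: J_time.
have [xx|/ltW xx] := leP x (xn n).
  rewrite ger0_norm ?subr_ge0 ?(J_homo M)//.
  by apply: le_trans (J_le_E M _ xx) _; exact: ler_norm.
rewrite distrC ger0_norm ?subr_ge0 ?(J_homo M)//.
by apply: le_trans (J_le_E M _ xx) _; rewrite distrC; exact: ler_norm.
Qed.

Lemma scalar_solution_exists :
  exists a Q K Z c, scalar_solution E J G zeta w0 a Q K Z c.
Proof.
(* One ultrafilter serves all times at once: every bounded sequence of scheme values converges along
   it, with no subsequence to extract. *)
have [U [UU ooU]] := ultraFilterLemma (@eventually_filter).
have PU : ProperFilter U by exact: ultra_proper.
pose hn n : R := n.+1%:R^-1.
have hn0 n : 0 < hn n by rewrite invr_gt0.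
pose idx n (t : R) := Num.truncn (t * n.+1%:R).
pose tn n t := (idx n t)%:R * hn n.
pose an n t := sch_a J G zeta w0 (hn n) (idx n t).
pose Kn n t := sch_K J G zeta w0 (hn n) (idx n t).
pose cn n s t := sch_c J G zeta w0 (hn n) (idx n s) (tn n t).
have idx_homo n s t : s <= t -> (idx n s <= idx n t)%N.
  by move=> st; apply: le_truncn; rewrite ler_wpM2r.
have idx0 n : idx n 0 = 0%N by rewrite /idx mul0r truncn0.
have tn_le n t : 0 <= t -> t - hn n <= tn n t <= t.
  move=> t0; have tn0 : 0 <= t * n.+1%:R by rewrite mulr_ge0.
  have /andP[H1 H2] := truncn_itv tn0.
  rewrite /tn /hn -/(idx n t) in H1 H2 *; apply/andP; split.
    rewrite lerBlDr -[X in _ + X]mul1r -mulrDl ler_pdivlMr//.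
    by rewrite natr1; exact: ltW.
  by rewrite ler_pdivrMr.
have tn_cvg t : 0 <= t -> tn n t @[n --> U] --> t.
  move=> t0; apply: (@squeeze_cvgr _ U _ _ (fun n => t - hn n) (fun=> t)).
  - by apply: nearW => n; exact: tn_le.
  - rewrite -[X in _ --> X]subr0; apply: cvgB; first exact: cvg_cst.
    by apply: cvg_trans (@cvg_harmonic R) => A /= HA; exact: ooU.
  - exact: cvg_cst.
have inv n t := sch_inv M (hn0 n) (idx n t).
have an_le n t : 0 <= t -> - w0 <= an n t <= t.
  move=> t0; have [/andP[H1 H2] _ _ _ _] := inv n t.
  have /andP[_ H3] := tn_le n t t0.
  by rewrite /an H1/= (le_trans H2).
have Kn_le n t : 0 <= t -> 0 <= Kn n t <= E t - E (- w0).
  move=> t0; have /andP[_] := sch_K_bounds M (hn0 n) (leq0n (idx n t)).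
  have := sch_K_homo M (hn0 n) (leq0n (idx n t)).
  rewrite {1 3}/sch_K /= subr0 => H1 H2; apply/andP; split => //.
  apply: le_trans H2 _; rewrite {2}/sch_a /=.
  have /andP[wa at_] := an_le n t t0.
  apply: le_trans (J_le_E M _ wa) _.
  by rewrite lerD2r (md_E M).
have cn_le n s t : 0 <= s -> 0 <= cn n s t <= E s - E (- w0).
  move=> s0; have := sch_c_bounds M (hn0 n) (tn n t) (leq0n (idx n s)).
  rewrite {1 3}/sch_K {2 3}/sch_c /= !subr0 => /andP[H1 H2].
  have /andP[K0 K1] := Kn_le n s s0.
  apply/andP; split; first by apply: le_trans H1; rewrite mulr_ge0// (G_ge0 M).
  apply: le_trans H2 _; apply: le_trans _ K1.
  by rewrite ler_piMl// (md_G1 M).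
have Hal : forall t : R, exists y : R, 0 <= t ->
    an n t @[n --> U] --> y /\ - w0 <= y <= t.
  move=> t; have [t0|t0] := leP 0 t; last by exists 0.
  by have [y yt yc] := ultra_cvg UU (fun n => an_le n t t0); exists y.
have [al alP] := choice Hal.
have HK : forall t : R, exists y : R, 0 <= t -> Kn n t @[n --> U] --> y.
  move=> t; have [t0|t0] := leP 0 t; last by exists 0.
  by have [y yt yc] := ultra_cvg UU (fun n => Kn_le n t t0); exists y.
have [K KP] := choice HK.
have Hc : forall p : R * R, exists y : R, 0 <= p.1 ->
    cn n p.1 p.2 @[n --> U] --> y.
  move=> [s t]; have [s0|s0] /= := leP 0 s; last by exists 0.
  by have [y yt yc] := ultra_cvg UU (fun n => cn_le n s t s0); exists y.
have [c' cP] := choice Hc.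
pose c s t := c' (s, t).
have alc t : 0 <= t -> an n t @[n --> U] --> al t by move=> /alP[].
have al_le t : 0 <= t -> - w0 <= al t <= t by move=> /alP[].
have Kc t : 0 <= t -> Kn n t @[n --> U] --> K t by exact: KP.
have cc s t : 0 <= s -> cn n s t @[n --> U] --> c s t by exact: (cP (s, t)).
pose Q t := J t t - J t (al t).
(* The limit [al t] need not be the maximal position with queue content [Q t], so it is moved there;
   by [Ea] and [Ja] this changes neither [E] nor any [J s]. *)
pose a t := frontier J w0 t (Q t).
pose Z t := zeta t + K t - c t t.
have Jal s t : 0 <= s -> 0 <= t -> J (tn n s) (an n t) @[n --> U] --> J s (al t).
  by move=> s0 t0; apply: J_cvg; [exact: tn_cvg|exact: alc].
have Qc t : 0 <= t -> sch_Q J G zeta w0 (hn n) (idx n t) @[n --> U] --> Q t.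
  by move=> t0; apply: cvgB; [apply: J_cvg; exact: tn_cvg|exact: Jal].
have Zc t : 0 <= t -> sch_Z J G zeta w0 (hn n) (idx n t) @[n --> U] --> Z t.
  move=> t0; apply: cvgB; last exact: cc.
  apply: cvgD; last exact: Kc.
  have cz : continuous zeta := md_zc M.
  by apply: continuous_cvg; [exact: cz|exact: tn_cvg].
have Gc s t : 0 <= s -> 0 <= t -> G (tn n t - tn n s) @[n --> U] --> G (t - s).
  move=> s0 t0; have cG : continuous G := md_Gc M.
  by apply: continuous_cvg; [exact: cG|apply: cvgB; exact: tn_cvg].
have al_homo s t : 0 <= s -> s <= t -> al s <= al t.
  move=> s0 st; apply: ler_cvg_to (alc _ s0) (alc _ (le_trans s0 st)) _.
  by apply: nearW => n; apply: (sch_a_homo M (hn0 n)); exact: idx_homo.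
have al_head x t : 0 <= x -> Fc x = 0 -> 0 <= t -> t - x <= al t.
  move=> x0 Fx t0.
  have H : tn n t - x @[n --> U] --> t - x.
    by apply: cvgB; [exact: tn_cvg|exact: cvg_cst].
  apply: ler_cvg_to H (alc _ t0) _.
  by apply: nearW => n; exact: (sch_head_ge M (hn0 n)).
have hP t : 0 <= t -> [/\ - w0 <= a t <= t, J t t - J t (a t) = Q t &
      forall x, - w0 <= x -> x <= t -> Q t <= J t t - J t x -> x <= a t].
  move=> t0; have /andP[H1 H2] := al_le t t0; apply: (frontierP M t0).
    by rewrite subr_ge0 (J_homo M).
  by rewrite lerD2l lerN2 (J_homo M).
have ala t : 0 <= t -> al t <= a t.
  move=> t0; have /andP[H1 H2] := al_le t t0.
  by have [_ _] := hP t t0; apply.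
have Jaal t : 0 <= t -> J t (a t) = J t (al t).
  by move=> t0; have [_ + _] := hP t t0; rewrite /Q; lra.
(* If [E] grew between [al t] and [a t], it would still grow to the right of some [u] slightly above
   [al t]. There [Fc (t - u) > 0] by [al_head], so [J t] would grow too, against [Jaal]. *)
have Ea t : 0 <= t -> E (a t) = E (al t).
  move=> t0; apply: le_anti; rewrite (md_E M (ala t t0)) andbT leNgt.
  apply/negP => Elt.
  have cE : continuous E := md_Ec M.
  have e0 : 0 < E (a t) - E (al t) by rewrite subr_gt0.
  have /cvgrPdist_lt/(_ _ e0)[d /= d0 dP] := cE (al t).
  pose u := al t + d / 2.
  have alu : al t < u by rewrite ltrDl divr_gt0.
  have Eu : E u < E (a t).
    have : `|E (al t) - E u| < E (a t) - E (al t).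
      by apply: dP => /=; rewrite /u ltr_norml; apply/andP; split; lra.
    by move=> /ltr_normlP[]; lra.
  have ua : u <= a t.
    by rewrite leNgt; apply/negP => /ltW/(md_E M); rewrite leNgt Eu.
  have [/andP[_ at_] _ _] := hP t t0.
  have Fu : 0 < Fc (t - u).
    rewrite lt_neqAle (md_Fc0 M) andbT; apply/eqP => /esym F0.
    have := al_head (t - u) t; rewrite subr_ge0 subKr.
    by move=> /(_ (le_trans ua at_) F0 t0); rewrite leNgt alu.
  have := md_Jge M t ua; rewrite Jaal// leNgt => /negP; apply.
  apply: (@le_lt_trans _ _ 0); first by rewrite subr_le0 (J_homo M)// ltW.
  by rewrite mulr_gt0// subr_gt0.
have Ja s t : 0 <= t -> J s (a t) = J s (al t).
  move=> t0; apply: le_anti.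
  rewrite (J_homo M s (ala t t0)) andbT -subr_le0.
  by apply: le_trans (J_le_E M _ (ala t t0)) _; rewrite Ea// subrr.
exists a, Q, K, Z, c; split.
- by move=> t t0; have [] := hP t t0.
- by move=> t t0; have [_ ->] := hP t t0.
- by move=> t x t0; have [_ _] := hP t t0; apply.
- move=> s t s0 st; have t0 := le_trans s0 st.
  have [/andP[ws sa] _ _] := hP s s0.
  have [_ _] := hP t t0; apply => //; first exact: le_trans st.
  by rewrite /Q lerD2l lerN2 Ja// (J_homo M)// al_homo.
- move=> s t s0 st; have t0 := le_trans s0 st; rewrite !Ja//.
  apply: (@ler_cvg_to _ U _ _
    (fun n => J (tn n t) (an n t) - J (tn n t) (an n s))
    (fun n => Kn n t - Kn n s)).
  + by apply: cvgB; exact: Jal.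
  + by apply: cvgB; exact: Kc.
  + apply: nearW => n.
    by have /andP[] := sch_K_bounds M (hn0 n) (idx_homo n _ _ st).
- move=> s t s0 st; have t0 := le_trans s0 st; rewrite !Ja//.
  apply: (@ler_cvg_to _ U _ _ (fun n => Kn n t - Kn n s)
    (fun n => J (tn n s) (an n t) - J (tn n s) (an n s))).
  + by apply: cvgB; exact: Kc.
  + by apply: cvgB; exact: Jal.
  + apply: nearW => n.
    by have /andP[] := sch_K_bounds M (hn0 n) (idx_homo n _ _ st).
- apply: (@cvg_unique _ _ (Kn n 0 @[n --> U])) (Kc 0 (lexx 0)) _ => //.
  by apply: cvg_near_cst; apply: nearW => n; rewrite /Kn idx0.
- by move=> t t0; rewrite /Z; ring.
- move=> t t0; apply: (@cvg_unique _ _ (cn n 0 t @[n --> U])) (cc 0 t (lexx 0)) _ => //.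
  by apply: cvg_near_cst; apply: nearW => n; rewrite /cn idx0.
- move=> s s' t s0 ss st; have s'0 := le_trans s0 ss; have t0 := le_trans s'0 st.
  apply: (@ler_cvg_to _ U _ _ (fun n => G (tn n t - tn n s') * (Kn n s' - Kn n s))
    (fun n => cn n s' t - cn n s t)).
  + by apply: cvgM; [exact: Gc|apply: cvgB; exact: Kc].
  + by apply: cvgB; exact: cc.
  + apply: nearW => n.
    by have /andP[] := sch_c_bounds M (hn0 n) (tn n t) (idx_homo n _ _ ss).
- move=> s s' t s0 ss st; have s'0 := le_trans s0 ss; have t0 := le_trans s'0 st.
  apply: (@ler_cvg_to _ U _ _ (fun n => cn n s' t - cn n s t)
    (fun n => G (tn n t - tn n s) * (Kn n s' - Kn n s))).
  + by apply: cvgB; exact: cc.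
  + by apply: cvgM; [exact: Gc|apply: cvgB; exact: Kc].
  + apply: nearW => n.
    by have /andP[] := sch_c_bounds M (hn0 n) (tn n t) (idx_homo n _ _ ss).
- move=> t t0; apply: (@ler_cvg_to _ U _ _
    (fun n => sch_Z J G zeta w0 (hn n) (idx n t)) (fun=> 1)).
  + exact: Zc.
  + exact: cvg_cst.
  + by apply: nearW => n; have [] := inv n t.
(* The ultrafilter decides the disjunction: one of the alternatives holds for [U]-most [n], hence in
   the limit. *)
- move=> t t0; have [H|H] := in_ultra_setVsetC
      [set n | sch_Q J G zeta w0 (hn n) (idx n t) = 0] UU.
    left; apply: (@cvg_unique _ _ (sch_Q J G zeta w0 (hn n) (idx n t) @[n --> U])) => //.
      exact: Qc.
    apply: cvg_near_cst; exact: H.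
  right; apply: (@cvg_unique _ _ (sch_Z J G zeta w0 (hn n) (idx n t) @[n --> U])) => //.
    exact: Zc.
  apply: cvg_near_cst; apply: filterS H => n /= H.
  by have [_ _ _ QZ _] := inv n t; case: QZ => [/H|].
- have al0 : al 0 = - w0.
    apply: (@cvg_unique _ _ (an n 0 @[n --> U])) (alc 0 (lexx 0)) _ => //.
    by apply: cvg_near_cst; apply: nearW => n; rewrite /an idx0.
  have [/andP[wa a0] _ _] := hP 0 (lexx 0).
  apply: le_anti; rewrite wa andbT; apply: (md_can M) => //.
  by rewrite Jaal// al0.
Qed.

End existence.

(** * Primitives of the arrival rate *)
Section primitive.
Variable R : realType.
Local Notation leb := (@lebesgue_measure R).

Lemma locally_integrable_itv (g : R -> R) (a b : R) :
  locally_integrable setT g -> leb.-integrable `]a, b] (EFin \o g).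
Proof.
move=> [mg _ gK]; apply: (@integrableS _ _ R leb `[a, b]%classic) => //.
  by apply: subset_itvr; rewrite bnd_simp.
apply/integrableP; split; last by apply: gK => //; exact: segment_compact.
by apply/measurable_EFinP; exact: measurable_funTS.
Qed.

Variable g : R -> R.
Hypothesis gint : forall a b, leb.-integrable `]a, b] (EFin \o g).

Lemma Rintegral_chasles x y z : x <= y -> y <= z ->
  Rintegral leb `]x, z] g = Rintegral leb `]x, y] g + Rintegral leb `]y, z] g.
Proof.
move=> xy yz; have := @Rintegral_itvB R g (BRight x) (BRight z) y (gint x z).
by rewrite !bnd_simp => /(_ xy yz) <-; rewrite addrC subrK.
Qed.

Lemma cum_arrivalsB x y : x <= y ->
  cum_arrivals g y - cum_arrivals g x = Rintegral leb `]x, y] g.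
Proof.
move=> xy; rewrite /cum_arrivals.
have [x0|x0] := leP 0 x.
  rewrite (le_trans x0 xy) (Rintegral_chasles x0 xy); ring.
have [y0|y0] := leP 0 y.
  rewrite (Rintegral_chasles (ltW x0) y0); ring.
rewrite (Rintegral_chasles xy (ltW y0)); ring.
Qed.

Lemma cum_arrivals0 : cum_arrivals g 0 = 0.
Proof. by rewrite /cum_arrivals lexx set_itvoc0 Rintegral_set0. Qed.

Lemma cum_arrivals_continuous : continuous (cum_arrivals g).
Proof.
move=> x; have xx : x - 1 < x + 1 by lra.
have gi : leb.-integrable `[x - 1, x + 1] (EFin \o g).
  apply: (@integrableS _ _ R leb `]x - 2, x + 1]%classic) => //.
  by apply: subset_itvr; rewrite bnd_simp; lra.
have := parameterized_integral_continuous (ltW xx) gi.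
move=> /(continuous_within_itvP _ xx)[+ _ _] => /(_ x).
rewrite in_itv /= ltrDl ltr01 ltrBlDr ltrDl ltr01 => /(_ isT) cx.
apply/cvgrPdist_lt => e e0.
move/cvgrPdist_lt : cx => /(_ e e0) H.
have near1 : \forall y \near x, x - 1 < y by apply: lt_nbhsr; rewrite ltrBlDr ltrDl.
near=> y.
have xy : x - 1 < y by near: y.
have x1 : x - 1 <= x by rewrite gerBl.
have : `|parameterized_integral leb (x - 1) x g -
    parameterized_integral leb (x - 1) y g| < e.
  by near: y.
rewrite /parameterized_integral -!Rintegral_itv_obnd_cbnd //.
rewrite -cum_arrivalsB// -cum_arrivalsB ?ltW// => H1.
by rewrite (_ : _ - _ = cum_arrivals g x - cum_arrivals g (x - 1) -
  (cum_arrivals g y - cum_arrivals g (x - 1)))//; ring.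
Unshelve. all: by end_near. Qed.

End primitive.

Section fluid_primitive.
Variable R : realType.
Local Notation leb := (@lebesgue_measure R).
Variables (F lam : R -> R) (L : R).
Local Notation Fc := (compl_dist F).
Hypothesis Fc_homo : {homo Fc : x y / x <= y >-> y <= x}.
Hypothesis Fc_ge0 : forall x, 0 <= Fc x.
Hypothesis Fc_le1 : forall x, Fc x <= 1.
Hypothesis Fc_lip : forall x y, x <= y -> Fc x - Fc y <= L * (y - x).
Hypothesis lam_ge0 : forall t, 0 <= lam t.
Hypothesis lam_loc : locally_integrable setT lam.

Definition queue_primitive (t : R) : R -> R :=
  cum_arrivals (fun s => Fc (t - s) * lam s).
Local Notation E := (cum_arrivals lam).
Local Notation J := queue_primitive.

Lemma measurable_fun_lam (D : set R) : measurable_fun D lam.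
Proof. by case: lam_loc => mlam _ _; exact: measurable_funTS. Qed.

Lemma measurable_fun_lam_reflect t (D : set R) :
  measurable_fun D (fun s => lam (t - s)).
Proof.
apply: measurable_funTS; rewrite (_ : (fun s => lam (t - s)) = lam \o (fun s => t - s))//.
apply: measurableT_comp; first exact: measurable_fun_lam.
by apply: measurable_funB => //; exact: measurable_cst.
Qed.

Lemma measurable_fun_Fc : measurable_fun setT Fc.
Proof. exact: nonincreasing_measurable. Qed.

Lemma measurable_fun_Fc_lam t (D : set R) :
  measurable D -> measurable_fun D (fun s => Fc (t - s) * lam s).
Proof.
move=> mD; apply: measurable_funM; last exact: measurable_fun_lam.
apply: measurable_funTS; apply: (measurableT_comp measurable_fun_Fc).
by apply: measurable_funB => //; exact: measurable_cst.
Qed.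

Lemma lam_int a b : leb.-integrable `]a, b] (EFin \o lam).
Proof. exact: locally_integrable_itv. Qed.

Lemma Fc_lam_int t a b :
  leb.-integrable `]a, b] (EFin \o (fun s => Fc (t - s) * lam s)).
Proof.
apply: (le_integrable _ _ _ (lam_int a b)) => //.
  by apply/measurable_EFinP; exact: measurable_fun_Fc_lam.
move=> s _ /=; rewrite lee_fin ger0_norm ?mulr_ge0//.
by rewrite ger0_norm// ler_piMl.
Qed.

Lemma cst_lam_int k a b :
  leb.-integrable `]a, b] (EFin \o (fun s => k * lam s)).
Proof. exact: (integrableZl _ k (lam_int a b)). Qed.

Lemma JB t x y : x <= y ->
  J t y - J t x = Rintegral leb `]x, y] (fun s => Fc (t - s) * lam s).
Proof. by move=> xy; apply: cum_arrivalsB => // a b; exact: Fc_lam_int. Qed.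

Lemma EB x y : x <= y -> E y - E x = Rintegral leb `]x, y] lam.
Proof. by move=> xy; apply: cum_arrivalsB => // a b; exact: lam_int. Qed.

Lemma E_homo : {homo E : x y / x <= y}.
Proof. by move=> x y xy; rewrite -subr_ge0 EB// Rintegral_ge0. Qed.

Lemma E_continuous : continuous E.
Proof. by apply: cum_arrivals_continuous => a b; exact: lam_int. Qed.

Lemma kE k x y : x <= y ->
  k * (E y - E x) = Rintegral leb `]x, y] (fun s => k * lam s).
Proof. by move=> xy; rewrite EB// RintegralZl//; exact: lam_int. Qed.

Lemma J_ge t x y : x <= y -> Fc (t - x) * (E y - E x) <= J t y - J t x.
Proof.
move=> xy; rewrite kE// JB//; apply: le_Rintegral => //.
- exact: cst_lam_int.
- exact: Fc_lam_int.
- move=> s; rewrite /= in_itv/= => /andP[xs sy].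
  by apply: ler_wpM2r => //; apply: Fc_homo; rewrite lerB// ltW.
Qed.

Lemma J_le t x y : x <= y -> J t y - J t x <= Fc (t - y) * (E y - E x).
Proof.
move=> xy; rewrite kE// JB//; apply: le_Rintegral => //.
- exact: Fc_lam_int.
- exact: cst_lam_int.
- move=> s; rewrite /= in_itv/= => /andP[xs sy].
  by apply: ler_wpM2r => //; apply: Fc_homo; rewrite lerB.
Qed.

Lemma J_shift t t' x y : t <= t' -> x <= y ->
  J t' y - J t' x <= J t y - J t x <=
  J t' y - J t' x + L * (t' - t) * (E y - E x).
Proof.
move=> tt xy; rewrite kE// !JB// -RintegralD//; last 2 first.
- exact: Fc_lam_int.
- exact: cst_lam_int.
apply/andP; split; apply: le_Rintegral => //; try exact: Fc_lam_int.
- move=> s _ /=; apply: ler_wpM2r => //; apply: Fc_homo.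
  by rewrite lerD2r.
- exact: (integrableD _ (Fc_lam_int t' x y) (cst_lam_int (L * (t' - t)) x y)).
- move=> s _ /=; rewrite -mulrDl; apply: ler_wpM2r => //.
  have tst : t - s <= t' - s by rewrite lerD2r.
  have := Fc_lip tst; rewrite (_ : t' - s - (t - s) = t' - t); last by ring.
  by rewrite lerBlDl.
Qed.

Lemma leb_reflect (t : R) (A : set R) : measurable A ->
  leb A = pushforward leb ((fun s => t - s) : R -> measurableTypeR R) A.
Proof.
have mphi : measurable_fun [set: R] ((fun s => t - s) : R -> measurableTypeR R).
  by apply: measurable_funB => //; exact: measurable_cst.
move=> mA; apply: lebesgue_measure_unique => // _ [[a b] _ <-].
rewrite -[RHS]/(leb ((fun s => t - s) @^-1` `]a, b]%classic)).
rewrite (_ : _ @^-1` _ = `[t - b, t - a[%classic); last first.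
  by apply/seteqP; split => s /=; rewrite !in_itv/= => /andP[? ?]; apply/andP; split; lra.
rewrite !lebesgue_measure_itv/= !lte_fin (_ : (t - b < t - a) = (a < b)).
  by case: ifP => // _; rewrite -!EFinD; congr EFin; ring.
by apply/idP/idP => ?; lra.
Qed.

Lemma FdE t x : 0 <= x -> Fd F lam t x = J t t - J t (t - x).
Proof.
move=> x0; have txt : t - x <= t by rewrite gerBl.
rewrite JB// /Fd.
have Iint a b : leb.-integrable `[a, b] (EFin \o (fun s => Fc (t - s) * lam s)).
  apply: (@integrableS _ _ R leb `]a - 1, b]%classic) => //.
    by apply: subset_itvr; rewrite bnd_simp; lra.
  exact: Fc_lam_int.
(* Reflection carries []0, x]] to [[t - x, t[]; the closed end is switched afterwards, points being
   Lebesgue-null. *)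
transitivity (Rintegral leb `[t - x, t[ (fun s => Fc (t - s) * lam s)).
  have mphi : measurable_fun [set: measurableTypeR R]
      ((fun s : R => t - s) : measurableTypeR R -> measurableTypeR R).
    by apply: measurable_funB => //; exact: measurable_cst.
  congr fine; rewrite (_ : `[t - x, t[%classic =
      ((fun s => t - s) : R -> measurableTypeR R) @^-1` `]0, x]%classic); last first.
    by apply/seteqP; split => s /=; rewrite !in_itv/= => /andP[? ?]; apply/andP; split; lra.
  under [RHS]eq_integral do rewrite -[X in lam X](subKr t).
  rewrite -(ge0_integral_pushforward mphi leb (D := `]0, x]%classic)
    (f := fun s => (Fc s * lam (t - s))%:E))//.
  - by apply: eq_measure_integral => //= A mA _; exact: leb_reflect.
  - apply/measurable_EFinP; apply: measurable_funM.
      by apply: measurable_funTS; exact: measurable_fun_Fc.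
    exact: measurable_fun_lam_reflect.
  - by move=> s _; rewrite lee_fin mulr_ge0.
rewrite Rintegral_itv_bndo_bndc; last first.
  by apply: integrableS (Iint (t - x) t) => //; apply: subset_itvl; rewrite bnd_simp.
by rewrite -Rintegral_itv_obnd_cbnd//; exact: Fc_lam_int.
Qed.

(** The substitution [x -> t - x] turns the infimum of waiting times into maximality of the arrival
    time, the form in which the selection enters [ss_can]. *)
Lemma Fd_inv_canonical w0 t w q : 0 <= w <= t + w0 -> q = J t t - J t (t - w) ->
  w = Fd_inv F lam w0 t q <->
  forall x, - w0 <= x -> x <= t -> q <= J t t - J t x -> x <= t - w.
Proof.
move=> /andP[w_ge0 wt] qE; rewrite /Fd_inv; set A := [set _ | _].
have Aw : A w by rewrite /A /= w_ge0 wt FdE// qE.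
have A0 : lbound A 0 by move=> x [/andP[]].
have hi : has_inf A by split; [exists w|exists 0].
split=> [wE x wx xt qx|can].
  rewrite lerBrDr -lerBrDl wE; apply: (ge_inf (proj2 hi)).
  by rewrite /A /= FdE ?subr_ge0// subKr qx xt; split => //; lra.
apply: le_anti; rewrite (ge_inf (proj2 hi))// andbT.
apply: lb_le_inf => [|x [/andP[x0 xt] qx]]; first by exists w.
by have := can (t - x); rewrite -FdE// => H; have := H _ _ qx; lra.
Qed.

End fluid_primitive.

(** * Lebesgue-Stieltjes integrals *)
Section stieltjes.
Variables (R : realType) (B : cumulative R R).
Local Notation mu := (lebesgue_stieltjes_measure B).

Lemma stieltjes_itv s t : s <= t -> mu `]s, t] = (B t - B s)%:E.
Proof.
move=> st; rewrite /lebesgue_stieltjes_measure /measure_extension/=.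
by rewrite measurable_mu_extE/= ?wlength_itv_bnd//; exact: is_ocitv.
Qed.

(** Continuity from above along the intervals []r - 1/(n+1), r]]; it converts a jump of [B] into an
    atom of dB. *)
Lemma stieltjes_set1_ge r b : (forall s, s < r -> b <= B r - B s) ->
  (b%:E <= mu [set r])%E.
Proof.
move=> bB; pose F n : set R := `]r - n.+1%:R^-1, r]%classic.
have FE n : mu (F n) = (B r - B (r - n.+1%:R^-1))%:E.
  by rewrite stieltjes_itv// gerBl.
have FI : \bigcap_n F n = [set r].
  apply/seteqP; split => [x Fx|_ -> n _]; last first.
    by rewrite /F/= in_itv/= lexx andbT ltrBlDr ltrDl invr_gt0.
  have xr : x <= r by have := Fx 0%N Logic.I; rewrite /F/= in_itv/= => /andP[].
  apply: le_anti; rewrite xr/= leNgt; apply/negP => xr'.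
  have := Fx (Num.truncn (r - x)^-1) Logic.I.
  rewrite /F/= in_itv/= => /andP[+ _]; apply/negP; rewrite -leNgt.
  have rx0 : 0 < r - x by rewrite subr_gt0.
  have rxi : 0 <= (r - x)^-1 by rewrite invr_ge0 ltW.
  rewrite lerBrDl -lerBrDr -[leRHS]invrK lef_pV2 ?posrE ?invr_gt0//.
  by have /andP[_ /ltW] := truncn_itv rxi.
have : mu \o F @ \oo --> mu (\bigcap_n F n).
  apply: nonincreasing_cvg_mu.
  - by rewrite [ltLHS]FE ltry.
  - by move=> n; exact: measurable_itv.
  - by apply: bigcapT_measurable => n; exact: measurable_itv.
  - move=> m n mn; apply/subsetPset => x; rewrite /F/= !in_itv/= => /andP[xl ->].
    rewrite andbT; apply: le_lt_trans xl; rewrite lerD2l lerN2 lef_pV2 ?posrE//.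
    by rewrite ler_nat.
rewrite FI => H; have <- := cvg_lim (@ereal_hausdorff R) H.
apply: lime_ge; first by apply/cvg_ex; exists (mu [set r]).
apply: nearW => n /=; rewrite [leRHS]FE lee_fin; apply: bB.
by rewrite ltrBlDr ltrDl invr_gt0.
Qed.

Variable f : R -> R.
Hypotheses (f0 : forall x, 0 <= f x) (f1 : forall x, f x <= 1).

Lemma stieltjes_integrable (s t : R) : measurable_fun `]s, t] f ->
  mu.-integrable `]s, t] (EFin \o f).
Proof.
move=> mf; have [ts|/ltW st] := leP t s.
  by rewrite set_itv_ge ?bnd_simp -?leNgt//; exact: integrable_set0.
apply/integrableP; split; first exact/measurable_EFinP.
apply: (@le_lt_trans _ _ (\int[mu]_(x in `]s, t]) 1)%E).
  apply: ge0_le_integral => //=.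
  - by apply/measurable_EFinP; apply: measurableT_comp.
  - by move=> x _; rewrite lee_fin ger0_norm.
rewrite integral_cst// mul1e.
by rewrite [ltLHS](stieltjes_itv st) ltry.
Qed.

Lemma stieltjes_Rintegral_le (s t k : R) : s <= t -> measurable_fun `]s, t] f ->
  (forall x, s < x -> x <= t -> f x <= k) ->
  Rintegral mu `]s, t] f <= k * (B t - B s).
Proof.
move=> st mf fk.
have -> : B t - B s = fine (mu `]s, t]) by rewrite stieltjes_itv.
rewrite -Rintegral_cst//; apply: le_Rintegral => //.
- exact: stieltjes_integrable.
- apply/integrableP; split; first exact/measurable_EFinP/measurable_cst.
  rewrite integral_cst//=; rewrite [in X in (_ * X)%E](stieltjes_itv st).
  by rewrite ltry.
- by move=> x; rewrite /= in_itv/= => /andP[sx xt]; exact: fk.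
Qed.

Lemma stieltjes_Rintegral_ge (s t k : R) : s <= t -> measurable_fun `]s, t] f ->
  (forall x, s < x -> x <= t -> k <= f x) ->
  k * (B t - B s) <= Rintegral mu `]s, t] f.
Proof.
move=> st mf fk.
have -> : B t - B s = fine (mu `]s, t]) by rewrite stieltjes_itv.
rewrite -Rintegral_cst//; apply: le_Rintegral => //.
- apply/integrableP; split; first exact/measurable_EFinP/measurable_cst.
  rewrite integral_cst//=; rewrite [in X in (_ * X)%E](stieltjes_itv st).
  by rewrite ltry.
- exact: stieltjes_integrable.
- by move=> x; rewrite /= in_itv/= => /andP[sx xt]; exact: fk.
Qed.

Lemma stieltjes_Rintegral_chasles (x y z : R) : x <= y -> y <= z ->
  measurable_fun `]x, z] f ->
  Rintegral mu `]x, z] f = Rintegral mu `]x, y] f + Rintegral mu `]y, z] f.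
Proof.
move=> xy yz mf; rewrite -Rintegral_setU//.
- by rewrite -itv_bndbnd_setU// bnd_simp.
- by rewrite -itv_bndbnd_setU ?bnd_simp//; exact: stieltjes_integrable.
- apply/disj_setPS => u [/=]; rewrite !in_itv/= => /andP[_ uy] /andP[yu _].
  by move: uy; rewrite leNgt yu.
Qed.

Lemma stieltjes_Rintegral_set1 (s r : R) : s < r -> measurable_fun `]s, r] f ->
  f r * fine (mu [set r]) <= Rintegral mu `]s, r] f.
Proof.
move=> sr mf; have rs : [set r] `<=` `]s, r].
  by move=> _ -> /=; rewrite in_itv/= sr lexx.
have int := stieltjes_integrable mf.
have mr : (mu [set r] < +oo)%E.
  apply: (@le_lt_trans _ _ (mu `]s, r])).
    by apply: le_measure => //; rewrite inE//; exact: measurable_set1.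
  by rewrite (stieltjes_itv (ltW sr)) ltry.
have -> : f r * fine (mu [set r]) = fine (\int[mu]_(x in [set r]) (f x)%:E)%E.
  rewrite (@eq_integral _ _ _ _ _ (fun=> (f r)%:E)); last first.
    by move=> x; rewrite inE/= => ->.
  by rewrite integral_cst// fineM// ge0_fin_numE.
apply: fine_le.
- apply: integrable_fin_num => //; exact: integrableS int.
- exact: integrable_fin_num.
- apply: ge0_subset_integral => //; first exact/measurable_EFinP.
  by move=> x _; rewrite lee_fin.
Qed.

End stieltjes.

(** * Service entry as a Stieltjes integral *)
Section sandwich.
Variables (R : realType) (Fc : R -> R) (L : R).
Hypothesis FcL : forall x y, x <= y -> Fc x - Fc y <= L * (y - x).
Hypothesis L0 : 0 <= L.

(* On a cell the two increments differ by at most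
   [L ((s - r) + (a s - a r)) (B s - B r)], and [B s - B r] is uniformly small. *)
Lemma mesh_sandwich (f g a B : R -> R) (x y : R) : x <= y ->
  (forall r s, x <= r -> r <= s -> s <= y -> a r <= a s) ->
  (forall r s, x <= r -> r <= s -> s <= y -> B r <= B s) ->
  (forall t, x <= t -> t <= y -> a t <= t) ->
  unif_cont_on B x y ->
  (forall r s, x <= r -> r <= s -> s <= y ->
     f s - f r <= Fc (r - a s) * (B s - B r)) ->
  (forall r s, x <= r -> r <= s -> s <= y ->
     Fc (s - a r) * (B s - B r) <= g s - g r) ->
  f y - f x <= g y - g x.
Proof.
move=> xy ah Bh at_ Bu fF Fg.
suff : f y - g y <= f x - g x by lra.
apply: (@mesh_le R (fun r => f r - g r) (fun r => r + a r) x y xy) => e e0.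
have L1 : 0 < L + 1 by rewrite ltr_wpDl.
have [d d0 dP] := Bu _ (divr_gt0 e0 L1).
exists d => // r s xr rs sy srd.
have ars := ah r s xr rs sy; have Brs := Bh r s xr rs sy.
have Be : B s - B r <= e / (L + 1).
  by apply: le_trans (ler_norm _) _; exact: dP.
have rsar : r - a s <= s - a r by rewrite lerB.
have H1 : (Fc (r - a s) - Fc (s - a r)) * (B s - B r) <=
    L * (s - a r - (r - a s)) * (B s - B r).
  by apply: ler_wpM2r; rewrite ?subr_ge0// FcL.
have H2 : L * (s - a r - (r - a s)) * (B s - B r) <=
    L * (s - a r - (r - a s)) * (e / (L + 1)).
  by apply: ler_wpM2l => //; rewrite mulr_ge0// subr_ge0.
have H3 : L * (s - a r - (r - a s)) * (e / (L + 1)) <= e * (s + a s - (r + a r)).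
  rewrite (_ : s - a r - (r - a s) = s + a s - (r + a r)); last by ring.
  have Le : L * (e / (L + 1)) <= e by rewrite mulrA ler_pdivrMr//; lra.
  by rewrite mulrAC; apply: ler_wpM2r => //; lra.
have := fF r s xr rs sy; have := Fg r s xr rs sy; lra.
Qed.

End sandwich.

Section convolution.
Variables (R : realType) (G : R -> R).
Hypothesis Gc : continuous G.

(** The upper and lower cell bounds differ by the oscillation of [G] times the increment of [K],
    which vanishes under refinement. Used in both directions, this identifies the abstract [c] with
    a Stieltjes convolution. *)
Lemma renewal_conv_unique (K : R -> R) (c1 c2 : R -> R) (t : R) : 0 <= t ->
  (forall s s', 0 <= s -> s <= s' -> s' <= t -> K s <= K s') ->
  (forall s s', 0 <= s -> s <= s' -> s' <= t ->
    c1 s' - c1 s <= G (t - s) * (K s' - K s)) ->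
  (forall s s', 0 <= s -> s <= s' -> s' <= t ->
    G (t - s') * (K s' - K s) <= c2 s' - c2 s) ->
  c1 0 = c2 0 -> c1 t <= c2 t.
Proof.
move=> t0 Kh H1 H2 c0.
suff : c1 t - c2 t <= c1 0 - c2 0 by rewrite c0 subrr subr_le0.
apply: (@mesh_le R (fun r => c1 r - c2 r) K 0 t t0) => e e0.
have [d d0 dP] := @continuous_unif_cont_on R G 0 t Gc e e0.
exists d => // r s r0 rs st srd.
have Ge : G (t - r) - G (t - s) <= e.
  apply: le_trans (ler_norm _) _; apply: dP.
  - by rewrite subr_ge0.
  - by rewrite lerB.
  - by rewrite gerBl.
  - by rewrite opprB addrC addrA subrK.
have : (G (t - r) - G (t - s)) * (K s - K r) <= e * (K s - K r).
  by apply: ler_wpM2r => //; rewrite subr_ge0 Kh.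
have := H1 r s r0 rs st; have := H2 r s r0 rs st; lra.
Qed.

End convolution.

Section service.
Variables (R : realType) (Fc G a w : R -> R) (B : cumulative R R).
Hypothesis Fc_homo : {homo Fc : x y / x <= y >-> y <= x}.
Hypothesis Fc_ge0 : forall x, 0 <= Fc x.
Hypothesis Fc_le1 : forall x, Fc x <= 1.
Hypothesis G_homo : {homo G : x y / x <= y}.
Hypothesis G_ge0 : forall x, 0 <= G x.
Hypothesis G_le1 : forall x, G x <= 1.
Hypothesis a_homo : forall s t, 0 <= s -> s <= t -> a s <= a t.
Hypothesis wE : forall t, 0 <= t -> w t = t - a t.
Local Notation mu := (lebesgue_stieltjes_measure B).

Definition service (t : R) : R := Rintegral mu `]0, t] (fun q => Fc (w q)).
(** The upper limit [s] is kept apart from the horizon [t] because the cell estimates vary [s] at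
    fixed [t]. *)
Definition renewal_conv (s t : R) : R :=
  Rintegral mu `]0, s] (fun q => G (t - q) * Fc (w q)).

Let wm (s t : R) : 0 <= s -> measurable_fun `]s, t] (fun q => Fc (w q)).
Proof.
move=> s0; apply: (measurableT_comp (f := Fc)).
  exact: nonincreasing_measurable.
(* [a] is monotone only on nonnegative times; composing with [Num.max 0] makes it monotone on the
   line and leaves it unchanged on []s, t]]. *)
have mt : measurable_fun setT (fun q : R => q - a (Num.max 0 q)).
  apply: measurable_funB => //; apply: nondecreasing_measurable => // x y xy.
  apply: a_homo; first by rewrite le_max lexx.
  by rewrite ge_max le_max lexx/= le_max xy orbT.
apply: eq_measurable_fun (measurable_funTS mt) => q.
rewrite inE/= in_itv/= => /andP[sq _].
have q0 : 0 <= q by rewrite (le_trans s0)// ltW.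
by rewrite wE// (max_idPr q0).
Qed.

Let cm (s t u : R) : 0 <= s -> measurable_fun `]s, t] (fun q => G (u - q) * Fc (w q)).
Proof.
move=> s0; apply: measurable_funM; last exact: wm.
apply: measurable_funTS; apply: (measurableT_comp (f := G)).
  exact: nondecreasing_measurable.
by apply: measurable_funB => //; exact: measurable_cst.
Qed.

Let c0 (u q : R) : 0 <= G (u - q) * Fc (w q). Proof. by rewrite mulr_ge0. Qed.
Let c1 (u q : R) : G (u - q) * Fc (w q) <= 1.
Proof. by rewrite mulr_ile1. Qed.

Let B_homo s t : s <= t -> B s <= B t.
Proof. exact: cumulative_is_nondecreasing. Qed.

Lemma service_integrable (t : R) :
  mu.-integrable `]0, t] (EFin \o (fun q => Fc (w q))).
Proof.
by apply: (@stieltjes_integrable R B (fun q => Fc (w q))) => //; exact: wm.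
Qed.

Lemma serviceB (s t : R) : 0 <= s -> s <= t ->
  service t - service s = Rintegral mu `]s, t] (fun q => Fc (w q)).
Proof.
move=> s0 st; rewrite /service.
rewrite (stieltjes_Rintegral_chasles B _ _ s0 st)//; last exact: wm.
by rewrite addrAC subrr add0r.
Qed.

Lemma renewal_convB (u s t : R) : 0 <= s -> s <= t ->
  renewal_conv t u - renewal_conv s u =
    Rintegral mu `]s, t] (fun q => G (u - q) * Fc (w q)).
Proof.
move=> s0 st; rewrite /renewal_conv.
rewrite (stieltjes_Rintegral_chasles B (c0 u) (c1 u) s0 st)//; last exact: cm.
by rewrite addrAC subrr add0r.
Qed.

Lemma service0 : service 0 = 0.
Proof. by rewrite /service set_itvoc0 Rintegral_set0. Qed.

Lemma renewal_conv0 (t : R) : renewal_conv 0 t = 0.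
Proof. by rewrite /renewal_conv set_itvoc0 Rintegral_set0. Qed.

Lemma service_ge (s t : R) : 0 <= s -> s <= t ->
  Fc (t - a s) * (B t - B s) <= service t - service s.
Proof.
move=> s0 st; rewrite serviceB//; apply: stieltjes_Rintegral_ge => //.
  exact: wm.
move=> q sq qt; have q0 : 0 <= q by rewrite (le_trans s0)// ltW.
rewrite wE//; apply: Fc_homo; rewrite lerB//.
by apply: a_homo => //; exact: ltW.
Qed.

Lemma service_le (s t : R) : 0 <= s -> s <= t ->
  service t - service s <= Fc (s - a t) * (B t - B s).
Proof.
move=> s0 st; rewrite serviceB//; apply: stieltjes_Rintegral_le => //.
  exact: wm.
move=> q sq qt; have q0 : 0 <= q by rewrite (le_trans s0)// ltW.
by rewrite wE//; apply: Fc_homo; rewrite lerB ?a_homo// ltW.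
Qed.

Lemma service_homo (s t : R) : 0 <= s -> s <= t -> service s <= service t.
Proof.
move=> s0 st; rewrite -subr_ge0; apply: le_trans (service_ge s0 st).
by rewrite mulr_ge0// subr_ge0 B_homo.
Qed.

Lemma service_set1 (s t : R) : 0 <= s -> s < t ->
  Fc (w t) * fine (mu [set t]) <= service t - service s.
Proof.
move=> s0 st; rewrite serviceB ?(ltW st)//.
by apply: (@stieltjes_Rintegral_set1 R B (fun q => Fc (w q))) => //; exact: wm.
Qed.

Let kint (k s t : R) : 0 <= s -> s <= t ->
  k * (service t - service s) = Rintegral mu `]s, t] (fun q => k * Fc (w q)).
Proof.
move=> s0 st; rewrite serviceB// RintegralZl//.
by apply: (@stieltjes_integrable R B (fun q => Fc (w q))) => //; exact: wm.
Qed.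

Let kintegrable (k s t : R) : 0 <= s -> 0 <= k <= 1 ->
  mu.-integrable `]s, t] (EFin \o (fun q => k * Fc (w q))).
Proof.
move=> s0 /andP[k0 k1]; apply: stieltjes_integrable => [x|x|].
- by rewrite mulr_ge0.
- by rewrite mulr_ile1.
- by apply: measurable_funM => //; exact: wm.
Qed.

Lemma renewal_conv_ge (s s' t : R) : 0 <= s -> s <= s' ->
  G (t - s') * (service s' - service s) <= renewal_conv s' t - renewal_conv s t.
Proof.
move=> s0 ss; rewrite kint// renewal_convB//; apply: le_Rintegral => //.
- by apply: kintegrable => //; rewrite G_ge0 G_le1.
- by apply: stieltjes_integrable => //; exact: cm.
- move=> q; rewrite /= in_itv/= => /andP[sq qs]; apply: ler_wpM2r => //.
  by apply: G_homo; rewrite lerB.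
Qed.

Lemma renewal_conv_le (s s' t : R) : 0 <= s -> s <= s' ->
  renewal_conv s' t - renewal_conv s t <= G (t - s) * (service s' - service s).
Proof.
move=> s0 ss; rewrite kint// renewal_convB//; apply: le_Rintegral => //.
- by apply: stieltjes_integrable => //; exact: cm.
- by apply: kintegrable => //; rewrite G_ge0 G_le1.
- move=> q; rewrite /= in_itv/= => /andP[sq qs]; apply: ler_wpM2r => //.
  by apply: G_homo; rewrite lerB// ltW.
Qed.

Lemma service_conv (t : R) :  0 <= t ->
  (\int[mu]_(q in `]0%R, t]) (Fc (w q) * compl_dist G (t - q))%:E)%E =
  (service t - renewal_conv t t)%:E.
Proof.
move=> t0; rewrite /service /renewal_conv -RintegralB//; last 2 first.
- by apply: (@stieltjes_integrable R B (fun q => Fc (w q))) => //; exact: wm.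
- by apply: stieltjes_integrable => //; exact: cm.
rewrite /Rintegral fineK; last first.
  apply: integrable_fin_num => //; apply: stieltjes_integrable => [x|x|].
  - by rewrite -[X in X - _]mul1r -mulrBl mulr_ge0// subr_ge0.
  - rewrite -[X in X - _]mul1r -mulrBl mulr_ile1// ?subr_ge0//.
    by rewrite gerBl.
  - by apply: measurable_funB; [exact: wm|exact: cm].
by apply: eq_integral => q _; rewrite /compl_dist; congr EFin; ring.
Qed.

End service.

(** * Measures determined by, and built from, half-lines *)
(** Half-lines form a pi-system generating the Borel sets, and those starting at [- n] exhaust the
    line with finite mass. *)
Lemma measure_unique_halfline (R : realType)
    (m1 m2 : {measure set (measurableTypeR R) -> \bar R}) :
  (forall x, (m1 (halfline x) < +oo)%E) ->
  (forall x, m1 (halfline x) = m2 (halfline x)) ->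
  forall A : set (measurableTypeR R), measurable A -> m1 A = m2 A.
Proof.
move=> m1y m12 A mA.
pose g (n : nat) : set (measurableTypeR R) := halfline (- n%:R).
apply: (@g_sigma_algebra_measure_unique _ R (measurableTypeR R)
  (@RGenOInfty.G R) _ g).
- by move=> _ [x ->]; exact: measurable_itv.
- by move=> i; exists (- i%:R).
- apply/seteqP; split => // x _; exists (Num.truncn `|x|).+1 => //.
  rewrite /g /halfline /= in_itv/= andbT ltrNl.
  have /andP[_] := truncn_itv (normr_ge0 x).
  by apply: le_lt_trans; rewrite -normrN ler_norm.
- move=> _ _ [x ->] [y ->]; exists (Num.max x y).
  apply/seteqP; split => u /=; rewrite !in_itv/= !andbT.
    by move=> [xu yu]; rewrite gt_max xu.
  by rewrite gt_max => /andP[].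
- by move=> _ [x ->]; exact: m12.
- by move=> k; exact: m1y.
- have : ((@ocitv R).-sigma).-measurable A := mA.
  by rewrite RGenOInfty.measurableE.
Qed.

Lemma fin_meas_unique (R : realType) (m1 m2 : fin_meas R) :
  (forall x, m1 (halfline x) = m2 (halfline x)) ->
  forall A : set (measurableTypeR R), measurable A -> m1 A = m2 A.
Proof.
apply: measure_unique_halfline => x.
by rewrite ltey_eq fin_num_measure//; exact: measurable_itv.
Qed.

(** Restriction to []x, y]] confines both measures to the region where the cumulative functions
    agree and makes them finite on half-lines. *)
Lemma stieltjes_unique (R : realType) (B B' : cumulative R R) (x y : R) :
  (forall t, x <= t -> B t = B' t) ->
  forall A : set (measurableTypeR R), measurable A -> A `<=` `]x, y] ->
  lebesgue_stieltjes_measure B A = lebesgue_stieltjes_measure B' A.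
Proof.
move=> BB A mA Axy.
have mD : measurable (`]x, y]%classic : set (measurableTypeR R)).
  exact: measurable_itv.
suff : mrestr (lebesgue_stieltjes_measure B) mD A =
    mrestr (lebesgue_stieltjes_measure B') mD A.
  by rewrite /mrestr (setIidl Axy).
have hE z : halfline z `&` `]x, y] = `]Num.max z x, y]%classic.
  apply/seteqP; split => u /=; rewrite /halfline /= !in_itv/= gt_max ?andbT.
    by move=> [-> /andP[-> ->]].
  by move=> /andP[/andP[-> ->] ->].
have mE (C : cumulative R R) z :
    mrestr (lebesgue_stieltjes_measure C) mD (halfline z) =
    if Num.max z x <= y then (C y - C (Num.max z x))%:E else 0%E.
  rewrite /mrestr hE; case: ifPn => [zy|]; first exact: stieltjes_itv.
  by rewrite -ltNge => /ltW yz; rewrite set_itv_ge ?measure0// bnd_simp -leNgt.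
apply: measure_unique_halfline mA => z.
  by rewrite [ltLHS]mE; case: ifP => _; rewrite ltry.
rewrite [LHS]mE [RHS]mE; case: ifP => // zy.
have xm : x <= Num.max z x by rewrite le_max lexx orbT.
by rewrite (BB _ xm) (BB _ (le_trans xm zy)).
Qed.

Section shifted_sum.
Context (R : realType) (m1 m2 : fin_meas R) (t : R).

(* Used with [m1] the fluid in service at time 0, whose residual times have
   decreased by [t], and [m2] the fluid that entered service since. *)
Definition shifted_sum (A : set (measurableTypeR R)) : \bar R :=
  (m1 [set v | (A `&` `]0%R, +oo[) (v - t)%R] + m2 (A `&` `]0%R, +oo[))%E.

Let mshift (A : set (measurableTypeR R)) : measurable A ->
  measurable ([set v | (A `&` `]0%R, +oo[) (v - t)] : set (measurableTypeR R)).
Proof.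
move=> mA.
have mf : measurable_fun [set: measurableTypeR R]
    ((fun v : R => v - t) : measurableTypeR R -> measurableTypeR R).
  by apply: measurable_funB => //; exact: measurable_cst.
rewrite -[X in measurable X]setTI; apply: (mf measurableT).
by apply: measurableI => //; exact: measurable_itv.
Qed.

Let mpos (A : set (measurableTypeR R)) : measurable A ->
  measurable (A `&` `]0%R, +oo[ : set (measurableTypeR R)).
Proof. by move=> mA; apply: measurableI => //; exact: measurable_itv. Qed.

Let sum0 : shifted_sum set0 = 0%E.
Proof.
by rewrite /shifted_sum set0I (_ : [set v | set0 _] = set0)// !measure0 adde0.
Qed.

Let sum_ge0 A : (0 <= shifted_sum A)%E.
Proof. by rewrite adde_ge0// measure_ge0. Qed.

Let sum_sigma_additive : semi_sigma_additive shifted_sum.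
Proof.
move=> U mU tU mUU.
have U1 : [set v | (\bigcup_n U n `&` `]0%R, +oo[) (v - t)] =
    \bigcup_n [set v | (U n `&` `]0%R, +oo[) (v - t)].
  apply/seteqP; split => v /=; first by move=> [[n _ Un] v0]; exists n.
  by move=> [n _ [Un v0]]; split => //; exists n.
have c1 : (\sum_(0 <= i < n) m1 [set v | (U i `&` `]0%R, +oo[) (v - t)%R])%E
    @[n --> \oo] --> m1 [set v | (\bigcup_n U n `&` `]0%R, +oo[) (v - t)].
  rewrite U1; apply: measure_sigma_additive; first by move=> n; exact: mshift.
  move=> i j _ _ [v [/= [Ui _] [Uj _]]]; apply: tU => //.
  by exists (v - t).
have c2 : (\sum_(0 <= i < n) m2 (U i `&` `]0%R, +oo[))%E
    @[n --> \oo] --> m2 (\bigcup_n U n `&` `]0%R, +oo[).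
  rewrite setI_bigcupl; apply: measure_sigma_additive.
    by move=> n; exact: mpos.
  move=> i j _ _ [v [/= [Ui _] [Uj _]]]; apply: tU => //.
  by exists v.
rewrite (_ : (fun n => _) = (fun n =>
    (\sum_(0 <= i < n) m1 [set v | (U i `&` `]0%R, +oo[) (v - t)%R]) +
    (\sum_(0 <= i < n) m2 (U i `&` `]0%R, +oo[)))%E); last first.
  by apply/funext => n; rewrite -big_split.
apply: cvgeD c1 c2.
by apply: fin_num_adde_defl; apply: fin_num_measure; exact: mpos.
Qed.

HB.instance Definition _ := isMeasure.Build _ _ _
  shifted_sum sum0 sum_ge0 sum_sigma_additive.

Let sum_fin : fin_num_fun shifted_sum.
Proof.
move=> A mA; rewrite fin_numD; apply/andP; split; apply: fin_num_measure.
  exact: mshift.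
exact: mpos.
Qed.

HB.instance Definition _ := Measure_isFinite.Build _ _ _ shifted_sum sum_fin.

Definition shifted_sum_measure : fin_meas R := shifted_sum.

Lemma shifted_sum_on_positive : on_positive shifted_sum_measure.
Proof.
rewrite /on_positive /shifted_sum_measure /= /shifted_sum.
rewrite (_ : `]-oo, 0%R]%classic `&` `]0%R, +oo[%classic = set0); last first.
  apply/seteqP; split => // v [/=]; rewrite !in_itv/= andbT => v0.
  by rewrite ltNge v0.
by rewrite (_ : [set v | set0 _] = set0)// !measure0 adde0.
Qed.

Lemma shifted_sum_halfline x : 0 <= x ->
  shifted_sum_measure (halfline x) = (m1 (halfline (x + t)%R) + m2 (halfline x))%E.
Proof.
move=> x0; rewrite /shifted_sum_measure /= /shifted_sum.
have -> : halfline x `&` `]0, +oo[%classic = halfline x.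
  apply/seteqP; split => v /=; rewrite /halfline /= !in_itv/= !andbT.
    by case.
  by move=> xv; split => //; exact: le_lt_trans xv.
congr (m1 _ + _)%E; apply/seteqP; split => v; rewrite /halfline /= !in_itv/= !andbT.
  by rewrite ltrBrDr.
by rewrite ltrBrDr.
Qed.

End shifted_sum.

Section residual.
Context (R : realType) (d : measure_display) (T : measurableType d).
Variables (P : probability T R) (X : {RV P >-> R}).
Variables (nu : {measure set (measurableTypeR R) -> \bar R}).
Variables (D : set (measurableTypeR R)) (g : R -> R) (t : R).
Hypotheses (mD : measurable D) (g0 : forall s, 0 <= g s).
Hypothesis gint : nu.-integrable D (EFin \o g).

Definition residual_prob (s : R) (A : set R) : \bar R :=
  P (X @^-1` [set v | A (v - (t - s))]).

(* The distribution of the residual [X - (t - s)], mixed over the arrival time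
   [s] with density [g] with respect to [nu]. *)
Definition residual (A : set (measurableTypeR R)) : \bar R :=
  (\int[nu]_(s in D) (residual_prob s A * (g s)%:E))%E.

Let mres (A : set (measurableTypeR R)) (s : R) : measurable A ->
  measurable (X @^-1` [set v | A (v - (t - s))]).
Proof.
move=> mA; rewrite -[X in measurable X]setTI.
have mf : measurable_fun setT (fun o => X o - (t - s)).
  by apply: measurable_funB => //; exact: measurable_cst.
exact: (mf measurableT A mA).
Qed.

Let mprob (A : set (measurableTypeR R)) : measurable A ->
  measurable_fun D (fun s => residual_prob s A).
Proof.
move=> mA; apply: measurable_funTS.
(* Measurability in [s] comes from the product: [residual_prob s A] is the probability of the
   section at [s] of the preimage of [A] under [h]. *)
pose h (x : measurableTypeR R * T) : R := X x.2 - (t - x.1).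
have mh : measurable_fun setT h.
  apply: measurable_funB.
    by apply: measurableT_comp => //; exact: measurable_snd.
  by apply: measurable_funB; [exact: measurable_cst|exact: measurable_fst].
have mhA : measurable (h @^-1` A).
  by rewrite -[X in measurable X]setTI; exact: mh.
apply: eq_measurable_fun (measurable_fun_xsection P mhA) => s _ /=.
rewrite /residual_prob; congr (P _); apply/seteqP; split => o /=.
  by rewrite /xsection /= inE.
by rewrite /xsection /= inE.
Qed.

Let mint (A : set (measurableTypeR R)) : measurable A ->
  measurable_fun D (fun s => residual_prob s A * (g s)%:E)%E.
Proof.
move=> mA; apply: emeasurable_funM; first exact: mprob.
exact: measurable_int gint.
Qed.

Let res0 : residual set0 = 0%E.
Proof.
rewrite /residual (eq_integral (fun=> 0%E)) ?integral0// => s _.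
by rewrite /residual_prob (_ : [set v | set0 _] = set0)// preimage_set0 measure0 mul0e.
Qed.

Let prob_ge0 s A : (0 <= residual_prob s A)%E.
Proof. exact: measure_ge0. Qed.

Let res_ge0 A : (0 <= residual A)%E.
Proof. by apply: integral_ge0 => s _; rewrite mule_ge0// lee_fin. Qed.

Let res_sigma_additive : semi_sigma_additive residual.
Proof.
move=> U mU tU mUU; rewrite [X in _ --> X](_ : _ =
  \int[nu]_(s in D) (\sum_(n <oo) (residual_prob s (U n) * (g s)%:E)))%E; last first.
  apply: eq_integral => s _; rewrite muleC.
  under eq_eseriesr do rewrite muleC.
  rewrite nneseriesZl; last by move=> *; exact: prob_ge0.
  congr (_ * _)%E; apply/esym/cvg_lim => //.
  rewrite /residual_prob.
  rewrite (_ : X @^-1` _ =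
    \bigcup_n (X @^-1` [set v | U n (v - (t - s))])); last first.
    by apply/seteqP; split => o /= [n _ Un]; exists n.
  apply: measure_sigma_additive; first by move=> n; exact: mres.
  move=> i j _ _ [om [/= Ui Uj]]; apply: tU => //.
  by exists (X om - (t - s)).
apply/cvg_closeP; split.
  by apply: is_cvg_nneseries => n _ _; exact: res_ge0.
rewrite closeE// integral_nneseries//.
- by move=> n; exact: mint.
- by move=> n s _; rewrite mule_ge0// lee_fin.
Qed.

HB.instance Definition _ := isMeasure.Build _ _ _
  residual res0 res_ge0 res_sigma_additive.

Lemma residual_setT : residual setT = (\int[nu]_(s in D) (g s)%:E)%E.
Proof.
apply: eq_integral => s _; rewrite /residual_prob.
by rewrite (_ : [set v | setT _] = setT)// preimage_setT probability_setT mul1e.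
Qed.

Let res_fin : fin_num_fun residual.
Proof.
move=> A mA; rewrite ge0_fin_numE//.
apply: (@le_lt_trans _ _ (residual setT)).
  by apply: le_measure; rewrite ?inE.
by rewrite residual_setT ltey_eq integrable_fin_num.
Qed.

HB.instance Definition _ := Measure_isFinite.Build _ _ _ residual res_fin.

Lemma residual_halfline x : residual (halfline x) =
  (\int[nu]_(s in D) (compl_dist (dist_fun X) (x + t - s) * g s)%:E)%E.
Proof.
apply: eq_integral => s _; rewrite EFinM; congr (_ * _)%E.
rewrite /residual_prob /compl_dist /dist_fun.
have mcdf : measurable (X @^-1` `]-oo, x + t - s]).
  by rewrite -[X in measurable X]setTI; exact: measurable_funP.
rewrite (_ : X @^-1` _ = ~` (X @^-1` `]-oo, x + t - s])); last first.
  apply/seteqP; split => o /=;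
    rewrite /halfline /= !in_itv/= ?andbT => H.
    by apply/negP; rewrite -ltNge; lra.
  by move/negP : H; rewrite -ltNge; lra.
rewrite probability_setC// EFinB; congr (_ - _)%E.
by rewrite fineK// fin_num_measure.
Qed.

Definition residual_measure : fin_meas R := residual.

End residual.

(** * Distribution functions and tails of measures *)

Section dist_fun_properties.
Context (R : realType) (d : measure_display) (T : measurableType d).
Variables (P : probability T R) (X : {RV P >-> R}).

Lemma EFin_dist_fun x : (dist_fun X x)%:E = cdf X x.
Proof. by rewrite /dist_fun fineK// fin_num_measure. Qed.

Lemma dist_fun_homo : {homo dist_fun X : x y / x <= y}.
Proof.
by move=> x y xy; rewrite -lee_fin !EFin_dist_fun; exact: cdf_nondecreasing.
Qed.

Lemma dist_fun_ge0 x : 0 <= dist_fun X x.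
Proof. by rewrite -lee_fin EFin_dist_fun cdf_ge0. Qed.

Lemma dist_fun_le1 x : dist_fun X x <= 1.
Proof. by rewrite -lee_fin EFin_dist_fun cdf_le1. Qed.

Lemma dist_fun_neg x : (forall v, 0 <= X v) -> x < 0 -> dist_fun X x = 0.
Proof.
move=> X0 x0; rewrite /dist_fun /cdf /distribution /pushforward.
rewrite (_ : X @^-1` _ = set0) ?measure0//.
apply/seteqP; split => // v /=; rewrite in_itv/= => Xx.
by have := le_lt_trans Xx x0; rewrite ltNge X0.
Qed.

(** Nonnegativity gives the value 0 only strictly below 0; continuity carries it to 0, which
    excludes an atom there. *)
Lemma dist_fun0 x : (forall v, 0 <= X v) -> continuous (dist_fun X) ->
  x <= 0 -> dist_fun X x = 0.
Proof.
move=> X0 cX; rewrite le_eqVlt => /predU1P[->|]; last exact: dist_fun_neg.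
apply: le_anti; rewrite dist_fun_ge0 andbT; apply/ler_addgt0Pl => e e0.
rewrite addr0; have [dl dl0 dP] := @continuous_unif_cont_on R _ (-1) 0 cX e e0.
pose r := - Num.min dl 1.
have r0 : r < 0 by rewrite oppr_lt0 lt_min dl0 ltr01.
have r1 : -1 <= r by rewrite lerN2 ge_min lexx orbT.
have rd : 0 - r <= dl by rewrite sub0r opprK ge_min lexx.
have := dP r 0 r1 (ltW r0) (lexx 0) rd.
by rewrite (dist_fun_neg X0 r0) subr0; apply: le_trans; exact: ler_norm.
Qed.

End dist_fun_properties.

Section tail.
Variables (R : realType) (m : fin_meas R).

Definition tail (x : R) : R := fine (m (halfline x)).

Let mh x : measurable (halfline x : set (measurableTypeR R)).
Proof. exact: measurable_itv. Qed.

Lemma EFin_tail x : (tail x)%:E = m (halfline x).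
Proof. by rewrite fineK// fin_num_measure. Qed.

Lemma tailB x y : x <= y -> (tail x - tail y)%:E = m `]x, y]%classic.
Proof.
move=> xy; rewrite EFinB !EFin_tail.
have -> : halfline x = `]x, y]%classic `|` halfline y.
  apply/seteqP; split => v; rewrite /halfline /= !in_itv/= !andbT.
    by move=> ->; have [vy|] := leP v y; [left|right].
  by move=> [/andP[]//|]; exact: le_lt_trans.
rewrite measureU//; last first.
  apply/seteqP; split => // v; rewrite /halfline /= !in_itv/= !andbT.
  by move=> [/andP[_ vy]]; rewrite ltNge vy.
by rewrite addeK// fin_num_measure.
Qed.

Lemma tail_homo : {homo tail : x y / x <= y >-> y <= x}.
Proof. by move=> x y xy; rewrite -subr_ge0 -lee_fin tailB. Qed.

(** Near [x] the oscillation of [tail] is at most the mass of a small interval around [x], and this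
    tends to the mass of the point. *)
Lemma tail_continuous : no_atoms m -> continuous tail.
Proof.
move=> na x; apply/cvgrPdist_lt => e e0.
pose F n : set (measurableTypeR R) := `]x - n.+1%:R^-1, x + n.+1%:R^-1]%classic.
have i0 n : 0 < n.+1%:R^-1 :> R by rewrite invr_gt0.
have mF n : measurable (F n) by exact: measurable_itv.
have FI : \bigcap_n F n = [set x].
  apply/seteqP; split => [y Fy|_ -> n _]; last first.
    by rewrite /F/= in_itv/= ltrBlDr ltrDl i0 lerDl ltW.
  apply/eqP; rewrite -subr_eq0 -normr_le0 leNgt; apply/negP => yx.
  have yxi : 0 <= `|y - x|^-1 by rewrite invr_ge0.
  have /andP[_ H] := truncn_itv yxi.
  have := Fy (Num.truncn `|y - x|^-1) Logic.I.
  rewrite /F/= in_itv/=; set k : R := (Num.truncn `|y - x|^-1).+1%:R in H *.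
  have k0 : 0 < k by rewrite /k ltr0n.
  have kyx : k^-1 < `|y - x| by rewrite invf_plt ?posrE.
  move=> /andP[yl yr]; move: kyx; apply/negP; rewrite -leNgt ler_norml.
  by apply/andP; split; move: (k^-1) yl yr => z; lra.
have cF : m \o F @ \oo --> 0%E.
  rewrite -(na x) -FI; apply: nonincreasing_cvg_mu => //.
  - by rewrite ltey_eq fin_num_measure.
  - exact: bigcapT_measurable.
  - move=> k l kl; apply/subsetPset => y; rewrite /F/= !in_itv/= => /andP[yl yr].
    have H : l.+1%:R^-1 <= k.+1%:R^-1 :> R by rewrite lef_pV2 ?posrE// ler_nat.
    by apply/andP; split; move: (l.+1%:R^-1) (k.+1%:R^-1) H yl yr => p q; lra.
have [z z0 mFz] : exists2 z, 0 < z & fine (m `]x - z, x + z]%classic) < e.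
  have /cvgrPdist_lt /(_ e e0)[n _ nP] : fine (m (F n)) @[n --> \oo] --> (0 : R).
    exact: fine_cvg cF.
  exists n.+1%:R^-1 => //; have := nP n (leqnn n).
  by rewrite /= sub0r normrN; apply: le_lt_trans; exact: ler_norm.
near=> y.
have : `|x - y| < z by near: y; exact: cvgr_dist_lt.
rewrite ltr_norml => /andP[yl yr].
have xzz : x - z <= x + z by lra.
move: mFz; rewrite -tailB//= => tlt.
have t1 : tail (x + z) <= tail y by apply: tail_homo; lra.
have t2 : tail y <= tail (x - z) by apply: tail_homo; lra.
have t3 : tail (x + z) <= tail x by apply: tail_homo; lra.
have t4 : tail x <= tail (x - z) by apply: tail_homo; lra.
by rewrite ltr_norml; apply/andP; split; lra.
Unshelve. all: by end_near. Qed.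

End tail.

(** * From the measure-valued model to the scalar system and back *)
Section fluid.
Context (R : realType) (dV : measure_display) (TV : measurableType dV).
Context (PV : probability TV R) (V : {RV PV >-> R}).
Context (dS : measure_display) (TS : measurableType dS).
Context (PS : probability TS R) (S : {RV PS >-> R}).
Context (lam : R -> R) (w0 : R) (R0 Z0 : fin_meas R).
Local Notation leb := (@lebesgue_measure R).
Local Notation F := (dist_fun V).
Local Notation G := (dist_fun S).
Local Notation Fc := (compl_dist F).
Local Notation E := (cum_arrivals lam).
Local Notation J := (queue_primitive F lam).
Hypothesis V_ge0 : forall v, 0 <= V v.
Hypothesis S_ge0 : forall s, 0 <= S s.
Hypothesis F_lip : lipschitz F.
Hypothesis G_cont : continuous G.
Hypothesis lam_ge0 : forall t, 0 <= lam t.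
Hypothesis lam_loc : locally_integrable setT lam.
Hypothesis init : valid_initial_state F lam w0 R0 Z0.

Lemma Fc_homo : {homo Fc : x y / x <= y >-> y <= x}.
Proof. by move=> x y xy; rewrite /compl_dist lerB// dist_fun_homo. Qed.

Lemma Fc_ge0 x : 0 <= Fc x.
Proof. by rewrite subr_ge0 dist_fun_le1. Qed.

Lemma Fc_le1 x : Fc x <= 1.
Proof. by rewrite gerBl dist_fun_ge0. Qed.

Lemma Fc_lipschitz : exists2 L, 0 <= L &
  forall x y, x <= y -> Fc x - Fc y <= L * (y - x).
Proof.
have [M [Mreal MP]] := F_lip.
exists (`|M| + 1); first by rewrite addr_ge0.
move=> x y xy; have MM : M < `|M| + 1 by rewrite (le_lt_trans (ler_norm _))// ltrDl.
have := MP _ MM (y, x) (conj Logic.I Logic.I) => /=.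
rewrite [X in _ <= _ * X]ger0_norm ?subr_ge0// => H.
by rewrite /compl_dist; apply: le_trans H; apply: le_trans (ler_norm _); lra.
Qed.

Section with_constant.
Variable L : R.
Hypothesis L_ge0 : 0 <= L.
Hypothesis FcL : forall x y, x <= y -> Fc x - Fc y <= L * (y - x).

Let JB' := JB Fc_homo Fc_ge0 Fc_le1 lam_ge0 lam_loc.
Let Fd_inv' := Fd_inv_canonical Fc_homo Fc_ge0 Fc_le1 lam_ge0 lam_loc.

Lemma queue_massE (Rm : fin_meas R) t w : 0 <= w ->
  (forall x, Rm (halfline x) =
    (\int[leb]_(s in `](t - w)%R, t]) (Fc (x + t - s) * lam s)%:E)%E) ->
  queue_mass Rm = J t t - J t (t - w).
Proof.
move=> w_ge0 RmE; rewrite JB' ?gerBl// /queue_mass RmE /Rintegral.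
by congr fine; apply: eq_integral => s _; rewrite add0r.
Qed.

(** Complementarity form of the non-idling constraints: uniqueness splits on it, and the ultralimit
    preserves it. *)
Lemma non_idlingP (Rm Zm : fin_meas R) : non_idling Rm Zm <->
  [/\ 0 <= queue_mass Rm, service_mass Zm <= 1 &
      queue_mass Rm = 0 \/ service_mass Zm = 1].
Proof.
rewrite /non_idling /system_mass; set q := queue_mass Rm; set z := service_mass Zm.
split=> [[qE zE]|[q0 z1 [qE|zE]]].
- have q0 : 0 <= q by rewrite qE le_max lexx orbT.
  split => //; first by rewrite zE ge_min lexx orbT.
  have [h|h] := leP (q + z) 1.
    by left; rewrite qE; apply/max_idPr; rewrite subr_le0.
  by right; rewrite zE; apply/min_idPr; exact: ltW.
- rewrite qE add0r; split; first by apply/esym/max_idPr; rewrite subr_le0.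
  by apply/esym/min_idPl.
- rewrite zE addrK; split; first by apply/esym/max_idPl.
  by apply/esym/min_idPr; rewrite lerDr.
Qed.

Lemma fluid_model_data : model_data E J Fc G (tail Z0) L w0.
Proof.
have [Zpos [R0na Z0na] om R0E ni] := init.
have [/andP[w0_ge0 _] _ w0E] := om.
have qE : queue_mass R0 = J 0 0 - J 0 (0 - w0).
  apply: queue_massE => // x; rewrite R0E sub0r.
  by apply: eq_integral => s _; rewrite addr0.
have [q0 z1 qz] := (non_idlingP _ _).1 ni.
split.
- exact: E_homo.
- exact: E_continuous.
- exact: Fc_homo.
- exact: Fc_ge0.
- exact: Fc_le1.
- by move=> x x0; rewrite /compl_dist dist_fun_neg// subr0.
- exact: FcL.
- by move=> t x y; apply: J_ge => //; [exact: Fc_homo|exact: Fc_ge0|exact: Fc_le1].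
- by move=> t x y; apply: J_le => //; [exact: Fc_homo|exact: Fc_ge0|exact: Fc_le1].
- move=> t t' x y; apply: J_shift => //.
  + exact: Fc_homo.
  + exact: Fc_ge0.
  + exact: Fc_le1.
- by move=> t; exact: cum_arrivals0.
- exact: L_ge0.
- exact: dist_fun_homo.
- exact: G_cont.
- by move=> x; exact: dist_fun0.
- exact: dist_fun_le1.
- exact: tail_homo.
- exact: tail_continuous.
- exact: w0_ge0.
- exact: z1.
- by move: qz; rewrite qE sub0r.
- move=> x wx x0 Jx; rewrite -sub0r.
  have w00 : 0 <= w0 <= 0 + w0 by rewrite w0_ge0 add0r lexx.
  apply: (Fd_inv' w00 qE).1 => //.
  by rewrite qE lerD2l lerN2 sub0r.
Qed.

Section solution.
Variables (Rt Zt : R -> fin_meas R) (w : R -> R) (B : cumulative R R).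
Hypothesis sol0 : forall A : set (measurableTypeR R), measurable A ->
  Rt 0 A = R0 A /\ Zt 0 A = Z0 A.
Hypothesis solP : forall t, 0 <= t ->
  [/\ on_positive (Zt t),
      is_omega F lam w0 t (Rt t) (w t) /\
      B t = cum_arrivals lam t - buffer_mass (Rt t),
      forall x : R, Rt t (halfline x) =
        (\int[leb]_(s in `](t - w t)%R, t])
           (compl_dist F (x + t - s) * lam s)%:E)%E,
      forall x : R, 0 <= x -> Zt t (halfline x) =
        (Zt 0%R (halfline (x + t)%R) +
         \int[lebesgue_stieltjes_measure B]_(s in `]0%R, t])
           (compl_dist F (w s) * compl_dist G (x + t - s))%:E)%E &
      non_idling (Rt t) (Zt t)].

Local Notation a := (fun t => t - w t).
Local Notation Q := (fun t => queue_mass (Rt t)).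
Local Notation Z := (fun t => service_mass (Zt t)).
Local Notation K := (service Fc w B).
Local Notation c := (renewal_conv Fc G w B).

Let w_itv t : 0 <= t -> 0 <= w t <= t + w0.
Proof. by move=> /solP[_ [[]]]. Qed.

Let a_itv t : 0 <= t -> - w0 <= a t <= t.
Proof. by move=> /w_itv/andP[? ?]; apply/andP; split; lra. Qed.

Let QE t : 0 <= t -> Q t = J t t - J t (a t).
Proof.
move=> t0; have /andP[w_ge0 _] := w_itv t0.
by have [_ _ RtE _ _] := solP t0; exact: queue_massE.
Qed.

Let canonical t x : 0 <= t -> - w0 <= x -> x <= t ->
  Q t <= J t t - J t x -> x <= a t.
Proof.
move=> t0; have [_ [[w_itvt _ wE] _] _ _ _] := solP t0.
exact: (Fd_inv' w_itvt (QE t0)).1.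
Qed.

Let BE t : 0 <= t -> B t = E (a t).
Proof.
move=> t0; have [_ [[/andP[w_ge0 _] bE _] ->] _ _ _] := solP t0.
rewrite bE -(EB lam_loc) ?gerBl//; ring.
Qed.

Let B_homo s t : s <= t -> B s <= B t.
Proof. exact: cumulative_is_nondecreasing. Qed.

Let M := fluid_model_data.

(** Monotonicity is given for [B], which is [E] along [a]. If [a t < a s], then [E], hence [J t], is
    constant between the two, and maximality of [a t] is contradicted. *)
Let a_homo s t : 0 <= s -> s <= t -> a s <= a t.
Proof.
move=> s0 st; have t0 := le_trans s0 st.
have /andP[ws as_] := a_itv s0.
rewrite leNgt; apply/negP => ats.
have Bst := B_homo st; rewrite !BE// in Bst.
have Ets := md_E M (ltW ats).
have Jts := J_le_E M t (ltW ats).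
move: ats; rewrite ltNge => /negP; apply.
by apply: canonical => //; [exact: le_trans st|rewrite QE//; lra].
Qed.

Let wE t : 0 <= t -> w t = t - a t. Proof. by rewrite subKr. Qed.

Let Fh := Fc_homo.
Let F0 := Fc_ge0.
Let F1 := Fc_le1.
Let G_homo := @dist_fun_homo _ _ _ _ S.
Let G0 := @dist_fun_ge0 _ _ _ _ S.
Let G1 := @dist_fun_le1 _ _ _ _ S.

Let KZ t : 0 <= t -> K t = Z t - tail Z0 t + c t t.
Proof.
move=> t0; have [_ _ _ ZE _] := solP t0.
rewrite /service_mass (ZE 0 (lexx 0)).
have /= -> := (sol0 (measurable_itv `]0 + t, +oo[)).2.
rewrite add0r -/(halfline t) (service_conv B Fh F0 F1 G_homo G0 G1 a_homo wE)//.
by rewrite -EFin_tail /=; ring.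
Qed.

Let Z1 t : 0 <= t -> Z t <= 1.
Proof. by move=> /solP[_ _ _ _ /non_idlingP[]]. Qed.

Let QZ t : 0 <= t -> Q t = 0 \/ Z t = 1.
Proof. by move=> /solP[_ _ _ _ /non_idlingP[]]. Qed.

Let K_homo := service_homo B Fh F0 F1 a_homo wE.

(* A jump of [B] at [r] is an atom of dB. If [Fc (w r) > 0] it would make [K]
   jump although the servers are all busy just before [r]. If [Fc (w r) = 0] then
   [w s <= w r] for all [s], so that [a s >= a r - (r - s)] and there is no jump. *)
Let B_left r e : 0 < r -> 0 < e -> exists2 s, 0 <= s < r & B r - B s < e.
Proof.
move=> r0 e0; apply: contrapT => H.
have Be s : s < r -> e <= B r - B s.
  move=> sr; rewrite leNgt; apply/negP => Bse; apply: H.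
  exists (Num.max 0 s); first by rewrite le_max lexx gt_max r0.
  apply: le_lt_trans Bse; rewrite lerD2l lerN2; apply: B_homo.
  by rewrite le_max lexx orbT.
have mue : e <= fine (lebesgue_stieltjes_measure B [set r]).
  have ltoo : (lebesgue_stieltjes_measure B [set r] < +oo)%E.
    apply: (@le_lt_trans _ _ (lebesgue_stieltjes_measure B `]0, r])).
      apply: le_measure; rewrite ?inE//.
      by move=> _ -> /=; rewrite in_itv/= r0 lexx.
    by rewrite [ltLHS](stieltjes_itv _ (ltW r0)) ltry.
  rewrite -lee_fin fineK; first exact: stieltjes_set1_ge.
  by rewrite ge0_fin_numE.
pose p := Fc (w r).
have r0' := ltW r0.
have cE : continuous E := md_Ec M.
have [d1 d10 dE1] := @continuous_unif_cont_on R E 0 r cE _ (divr_gt0 e0 (ltr0n _ 2)).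
have [d2 d20 dE2] := @continuous_unif_cont_on R E (a r - 1) (a r) cE _ (divr_gt0 e0 (ltr0n _ 2)).
(* Just before the jump the servers are full: an empty queue at [s] means [a s = s], and then
   [B r - B s] is at most the arrivals over []s, r]]. *)
have key s : 0 <= s -> s < r -> r - s <= d1 -> Z s = 1.
  move=> s0 sr rs; have [Qs|//] := QZ s0; exfalso.
  have as_ : a s = s.
    have /andP[ws ass] := a_itv s0; apply: le_anti; rewrite ass/=.
    by apply: canonical => //; [exact: le_trans ass|rewrite Qs subrr].
  have := Be s sr; rewrite !BE// as_.
  have /andP[_ /(md_E M)] := a_itv r0'.
  have := dE1 s r s0 (ltW sr) (lexx _) rs => /ler_normlP[_]; lra.
have [p0|p0] := eqVneq p 0.
  pose m := Num.min 1 (Num.min d2 (r / 2)).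
  have m0 : 0 < m by rewrite !lt_min ltr01 d20 divr_gt0.
  have m1 : m <= 1 by rewrite ge_min lexx.
  have md2 : m <= d2 by rewrite !ge_min lexx orbT.
  have mr : m <= r / 2 by rewrite !ge_min lexx !orbT.
  have s0 : 0 <= r - m by lra.
  have sr : r - m < r by lra.
  have /andP[aws ass] := a_itv s0.
  have aram : a r - m <= a (r - m).
    have /andP[wr_ge0 _] := w_itv r0'.
    rewrite (_ : a r - m = r - m - w r); last by ring.
    apply: (canonical_ge M) => // x wx xs Jx; apply: canonical => //.
    by rewrite QE// lerD2l lerN2.
  have := Be _ sr; rewrite !BE//.
  have H1 : a r - 1 <= a r - m by lra.
  have H2 : a r - m <= a r by lra.
  have H3 : a r - (a r - m) <= d2 by lra.
  have := dE2 _ _ H1 H2 (lexx _) H3 => /ler_normlP[_].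
  have := md_E M aram; lra.
have p_gt0 : 0 < p by rewrite lt_neqAle eq_sym p0 Fc_ge0.
have [d3 d30 dK] := service_modulus M r K_homo (service0 Fc w B) KZ
  (fun t _ => renewal_conv0 Fc G w B t)
  (fun s s' t s0 ss _ => renewal_conv_ge B Fh F0 F1 G_homo G0 G1 a_homo wE t s0 ss)
  (fun s s' t s0 ss _ => renewal_conv_le B Fh F0 F1 G_homo G0 G1 a_homo wE t s0 ss)
  Z1 (mulr_gt0 p_gt0 (divr_gt0 e0 (ltr0n _ 2))).
pose m := Num.min r (Num.min d1 d3).
have m0 : 0 < m by rewrite !lt_min r0 d10 d30.
have mr : m <= r by rewrite ge_min lexx.
have md1 : m <= d1 by rewrite !ge_min lexx orbT.
have md3 : m <= d3 by rewrite !ge_min lexx !orbT.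
have s0 : 0 <= r - m by lra.
have sr : r - m < r by lra.
have rsm : r - (r - m) = m by rewrite subKr.
have Zs : Z (r - m) = 1 by apply: key => //; rewrite rsm.
have KK := dK _ _ s0 (ltW sr) (lexx _) _ Zs; rewrite rsm in KK.
have := KK md3.
have := service_set1 B Fh F0 F1 a_homo wE s0 sr.
have : p * e <= p * fine (lebesgue_stieltjes_measure B [set r]).
  by apply: ler_wpM2l => //; exact: ltW.
have : 0 < p * e by rewrite mulr_gt0.
rewrite -/p; lra.
Qed.

Let B_unif T : unif_cont_on B 0 T.
Proof.
(* Composition with [Num.max 0] discards negative times, from which [B] might jump at 0; at positive
   times left continuity is [B_left]. *)
pose Bp t := B (Num.max 0 t).
have cBp : continuous Bp.
  move=> r; apply/cvgrPdist_lt => e e0.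
  have [d1 d10 dr] : exists2 d1, 0 < d1 & B (Num.max 0 r + d1) <= B (Num.max 0 r) + e / 2.
    have e20 : 0 < e / 2 by rewrite divr_gt0.
    have /cvgrPdist_le/(_ _ e20)[d1 /= d10 dP] :=
      @cumulative_is_right_continuous _ _ _ B (Num.max 0 r).
    exists (d1 / 2); first by rewrite divr_gt0.
    have := dP (Num.max 0 r + d1 / 2).
    rewrite /= opprD addNKr normrN gtr0_norm ?divr_gt0// ltrDl divr_gt0//.
    rewrite ltr_pdivrMr// ltr_pMr// ltr1n => /(_ isT isT).
    by move=> /ler_normlP[]; lra.
  have [d2 d20 dl] : exists2 d2, 0 < d2 &
      B (Num.max 0 r) - e / 2 <= B (Num.max 0 (r - d2)).
    have [r0|r0] := leP r 0.
      exists 1 => //; rewrite (max_idPl _); last by lra.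
      have := divr_gt0 e0 (ltr0n R 2); lra.
    have [s /andP[s0 sr] Bs] := B_left r0 (divr_gt0 e0 (ltr0n R 2)).
    exists (r - s); first by rewrite subr_gt0.
    by rewrite subKr (max_idPr s0); lra.
  near=> y.
  have y1 : y < r + d1 by near: y; apply: lt_nbhsl; rewrite ltrDl.
  have y2 : r - d2 < y by near: y; apply: lt_nbhsr; rewrite ltrBlDr ltrDl.
  have H1 : Bp y <= B (Num.max 0 r + d1).
    apply: B_homo; rewrite ge_max addr_ge0 ?le_max ?lexx ?(ltW d10)//=.
    by apply: (le_trans (ltW y1)); rewrite lerD2r le_max lexx orbT.
  have H2 : B (Num.max 0 (r - d2)) <= Bp y.
    apply: B_homo; rewrite ge_max le_max lexx/= le_max.
    by rewrite (ltW y2) orbT.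
  by rewrite ltr_norml; apply/andP; split; rewrite /Bp in H1 H2 *; lra.
have Bu := @continuous_unif_cont_on R Bp 0 T cBp.
move=> e /Bu[d d0 dP]; exists d => // r s r0 rs sT srd.
by have := dP r s r0 rs sT srd; rewrite /Bp !(max_idPr _)// (le_trans r0).
Unshelve. all: by end_near. Qed.

(** Freezing the time of [J] at the later end underestimates the patience of departing fluid, at the
    earlier end overestimates it. On each cell this gives the one-sided bound that [mesh_sandwich]
    pairs with [service_ge] or [service_le]. *)
Lemma fluid_solution_scalar : scalar_solution E J G (tail Z0) w0 a Q K Z c.
Proof.
have EB' r s : 0 <= r -> r <= s -> E (a s) - E (a r) = B s - B r.
  by move=> r0 rs; rewrite !BE// (le_trans r0).
split.
- exact: a_itv.
- exact: QE.
- exact: canonical.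
- exact: a_homo.
- move=> s t s0 st.
  apply: (mesh_sandwich FcL L_ge0 (f := fun q => J t (a q)) st (a := a) (B := B)).
  + by move=> r r' sr rr _; apply: a_homo => //; exact: le_trans sr.
  + by move=> r r' _ rr _; exact: B_homo.
  + by move=> r sr _; have /andP[] := a_itv (le_trans s0 sr).
  + exact: unif_cont_onW s0 (lexx t) (@B_unif t).
  + move=> r r' sr rr r't; have r0 := le_trans s0 sr.
    have aa := a_homo r0 rr.
    apply: le_trans (md_Jle M t aa) _; rewrite EB'//.
    apply: ler_wpM2r; first by rewrite subr_ge0 B_homo.
    by apply: Fc_homo; rewrite lerD2r (le_trans rr).
  + move=> r r' sr rr r't.
    by apply: (service_ge B Fh F0 F1 a_homo wE) => //; exact: le_trans sr.
- move=> s t s0 st.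
  apply: (mesh_sandwich FcL L_ge0 (g := fun q => J s (a q)) st (a := a) (B := B)).
  + by move=> r r' sr rr _; apply: a_homo => //; exact: le_trans sr.
  + by move=> r r' _ rr _; exact: B_homo.
  + by move=> r sr _; have /andP[] := a_itv (le_trans s0 sr).
  + exact: unif_cont_onW s0 (lexx t) (@B_unif t).
  + move=> r r' sr rr r't.
    by apply: (service_le B Fh F0 F1 a_homo wE) => //; exact: le_trans sr.
  + move=> r r' sr rr r't; have r0 := le_trans s0 sr.
    have aa := a_homo r0 rr.
    apply: le_trans (md_Jge M s aa); rewrite EB'//.
    apply: ler_wpM2r; first by rewrite subr_ge0 B_homo.
    by apply: Fc_homo; rewrite lerD2r (le_trans sr).
- exact: service0.
- exact: KZ.
- by move=> t _; exact: renewal_conv0.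
- move=> s s' t s0 ss _.
  exact: (renewal_conv_ge B Fh F0 F1 G_homo G0 G1 a_homo wE).
- move=> s s' t s0 ss _.
  exact: (renewal_conv_le B Fh F0 F1 G_homo G0 G1 a_homo wE).
- exact: Z1.
- exact: QZ.
- have [_ [[_ _ w0E] _] _ _ _] := solP (lexx 0).
  have [_ _ [_ _ w0E'] _ _] := init.
  suff -> : w 0 = w0 by rewrite sub0r.
  rewrite w0E [RHS]w0E' /queue_mass.
  by rewrite (sol0 (measurable_itv `]0, +oo[)).1.
Qed.

End solution.
Lemma fluid_solution_exists :
  exists Rt Zt, fluid_solution F G lam w0 R0 Z0 Rt Zt.
Proof.
have M := fluid_model_data.
have [a [Q [K [Z [c SS]]]]] := scalar_solution_exists M.
have a_homo := ss_mono SS.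
(* [a] itself may jump across stretches without arrivals, so continuity is claimed only for [E]
   along [a]; negative times repeat the value at 0. *)
pose Bf t := E (a (Num.max 0 t)).
have BfE t : 0 <= t -> Bf t = E (a t) by move=> t0; rewrite /Bf (max_idPr t0).
have Bf_homo : nondecreasing Bf.
  move=> x y xy; apply: (md_E M); apply: a_homo; first by rewrite le_max lexx.
  by rewrite ge_max le_max lexx/= le_max xy orbT.
have Bu T : 0 <= T -> unif_cont_on (E \o a) 0 T.
  exact: (departure_unif_cont M SS).
have Bf_cont : continuous Bf.
  move=> r; apply/cvgrPdist_le => e e0.
  pose T := Num.max 0 r + 1.
  have r0T : 0 <= Num.max 0 r by rewrite le_max lexx.
  have T0 : 0 <= T by rewrite addr_ge0.
  have [d d0 dP] := Bu T T0 e e0.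
  near=> y.
  have yd : `|r - y| < d by near: y; exact: cvgr_dist_lt.
  have y1 : y < r + 1 by near: y; apply: lt_nbhsl; rewrite ltrDl.
  have y0 : 0 <= Num.max 0 y by rewrite le_max lexx.
  have rmax : r <= Num.max 0 r by rewrite le_max lexx orbT.
  have ymax : y <= Num.max 0 y by rewrite le_max lexx orbT.
  have yT : Num.max 0 y <= T.
    by rewrite ge_max T0/= /T (le_trans (ltW y1))// lerD2r.
  move: yd; rewrite ltr_norml => /andP[yd1 yd2].
  have [ry|/ltW yr] := leP r y.
    have rym : Num.max 0 r <= Num.max 0 y.
      by rewrite ge_max y0/= (le_trans ry).
    rewrite distrC; apply: dP => //.
    have : Num.max 0 y <= Num.max 0 r + d by rewrite ge_max; apply/andP; split; lra.
    lra.
  have yrm : Num.max 0 y <= Num.max 0 r.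
    by rewrite ge_max r0T/= (le_trans yr).
  apply: dP => //; first by rewrite /T lerDl.
  have : Num.max 0 r <= Num.max 0 y + d by rewrite ge_max; apply/andP; split; lra.
  lra.
have Bf_rc : right_continuous Bf by exact: right_continuousW.
pose B : cumulative R R :=
  HB.pack Bf (isCumulative.Build R _ R Bf Bf_homo Bf_rc).
have BE t : 0 <= t -> B t = E (a t) by exact: BfE.
pose w t := t - a t.
have wE t : 0 <= t -> w t = t - a t by [].
have Fh := Fc_homo; have F0 := Fc_ge0; have F1 := Fc_le1.
have G_homo := @dist_fun_homo _ _ _ _ S.
have G0 := @dist_fun_ge0 _ _ _ _ S.
have G1 := @dist_fun_le1 _ _ _ _ S.
have dB r s : 0 <= r -> r <= s -> E (a s) - E (a r) = B s - B r.
  by move=> r0 rs; rewrite !BE// (le_trans r0).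
have BuT T : 0 <= T -> unif_cont_on B 0 T.
  move=> T0 e /(Bu T T0)[d d0 dP]; exists d => // r s r0 rs sT srd.
  by rewrite -dB//; exact: dP.
have a_le t : 0 <= t -> - w0 <= a t <= t by exact: (ss_a SS).
have K_ge r s : 0 <= r -> r <= s -> Fc (s - a r) * (B s - B r) <= K s - K r.
  move=> r0 rs; apply: le_trans (ss_Kge SS r0 rs); rewrite -dB//.
  exact: (md_Jge M s (a_homo _ _ r0 rs)).
have K_le r s : 0 <= r -> r <= s -> K s - K r <= Fc (r - a s) * (B s - B r).
  move=> r0 rs; apply: le_trans (ss_Kle SS r0 rs) _; rewrite -dB//.
  exact: (md_Jle M r (a_homo _ _ r0 rs)).
(* Both sides satisfy the same cell bounds, so [mesh_sandwich] in the two directions forces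
   equality. *)
have KE t : 0 <= t -> K t = service Fc w B t.
  move=> t0; suff : K t - K 0 = service Fc w B t - service Fc w B 0.
    by rewrite (ss_K0 SS) service0 !subr0.
  have ah r s : 0 <= r -> r <= s -> s <= t -> a r <= a s by move=> ? ? _; exact: a_homo.
  have Bh r s : 0 <= r -> r <= s -> s <= t -> B r <= B s.
    by move=> _ rs _; exact: cumulative_is_nondecreasing.
  have at_ r : 0 <= r -> r <= t -> a r <= r by move=> /a_le/andP[].
  apply: le_anti; apply/andP; split.
    apply: (mesh_sandwich FcL L_ge0 t0 ah Bh at_ (BuT t t0)) => r s r0 rs _.
      exact: K_le.
    exact: (service_ge B Fh F0 F1 a_homo wE).
  apply: (mesh_sandwich FcL L_ge0 t0 ah Bh at_ (BuT t t0)) => r s r0 rs _.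
    exact: (service_le B Fh F0 F1 a_homo wE).
  exact: K_ge.
have cE t : 0 <= t -> c t t = renewal_conv Fc G w B t t.
  move=> t0.
  have Kh s s' : 0 <= s -> s <= s' -> s' <= t -> K s <= K s'.
    by move=> s0 ss _; exact: (ss_homo_K M SS).
  have c0 : c 0 t = renewal_conv Fc G w B 0 t by rewrite (ss_c0 SS t0) renewal_conv0.
  have KKE s s' : 0 <= s -> s <= s' ->
      K s' - K s = service Fc w B s' - service Fc w B s.
    by move=> s0 ss; rewrite !KE// (le_trans s0).
  apply: le_anti; apply/andP; split.
    apply: (renewal_conv_unique G_cont (K := K) (c1 := fun s => c s t)
      (c2 := fun s => renewal_conv Fc G w B s t)) => // s s' s0 ss st.
      exact: ss_cle SS _ _ _ s0 ss st.
    by rewrite KKE//; exact: (renewal_conv_ge B Fh F0 F1 G_homo G0 G1 a_homo wE).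
  apply: (renewal_conv_unique G_cont (K := K) (c2 := fun s => c s t)
      (c1 := fun s => renewal_conv Fc G w B s t)) => // s s' s0 ss st.
    by rewrite KKE//; exact: (renewal_conv_le B Fh F0 F1 G_homo G0 G1 a_homo wE).
  exact: ss_cge SS _ _ _ s0 ss st.
have w_itv t : 0 <= t -> 0 <= w t <= t + w0.
  by move=> /a_le/andP[? ?]; rewrite /w; apply/andP; split; lra.
(* At time 0 the initial measure itself is taken, its equations being part of [valid_initial_state];
   later states are mixtures of residual patience laws over the arrivals. *)
have HR t : exists Rm : fin_meas R, (t <= 0 -> Rm = R0) /\
    (0 < t -> buffer_mass Rm = Rintegral leb `](t - w t), t] lam /\
      forall x, Rm (halfline x) = (\int[leb]_(s in `](t - w t)%R, t])
        (Fc (x + t - s) * lam s)%:E)%E).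
  have [t0|t0] := leP t 0; first by exists R0.
  exists (residual_measure V t (measurable_itv `](t - w t), t]) lam_ge0
    (lam_int lam_loc _ _)); split => //.
  split; last exact: residual_halfline.
  by rewrite /buffer_mass [X in fine X]residual_setT.
have [Rt RtP] := choice HR.
have FwI t : (lebesgue_stieltjes_measure B).-integrable `]0, t]
    (EFin \o (fun q => Fc (w q))).
  exact: (service_integrable B Fh F0 F1 a_homo wE).
have HZ t : exists Zm : fin_meas R, (t <= 0 -> Zm = Z0) /\
    (0 < t -> on_positive Zm /\ forall x, 0 <= x -> Zm (halfline x) =
       (Z0 (halfline (x + t)%R) + \int[lebesgue_stieltjes_measure B]_(s in `]0%R, t])
         (Fc (w s) * compl_dist G (x + t - s))%:E)%E).
  have [t0|t0] := leP t 0; first by exists Z0.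
  exists (shifted_sum_measure Z0 (residual_measure S t
    (measurable_itv `]0, t]) (fun q => F0 (w q)) (FwI t)) t); split => //.
  split=> [|x x0]; first exact: shifted_sum_on_positive.
  rewrite shifted_sum_halfline//; congr (_ + _)%E.
  rewrite [LHS]residual_halfline.
  by apply: eq_integral => s _; rewrite mulrC.
have [Zt ZtP] := choice HZ.
have Rt0 : Rt 0 = R0 by have [+ _] := RtP 0; apply.
have Zt0 : Zt 0 = Z0 by have [+ _] := ZtP 0; apply.
exists Rt, Zt, w, B; split; first by move=> A _; rewrite Rt0 Zt0.
move=> t; rewrite le_eqVlt => /predU1P[<-|t_gt0].
  have [Zpos _ om R0E ni] := init.
  have w00 : w 0 = w0 by rewrite /w (ss_a0 SS) sub0r opprK.
  rewrite Rt0 Zt0 w00; split => //.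
  - split => //; rewrite BE// (ss_a0 SS).
    have [/andP[w0_ge0 _] -> _] := om.
    by rewrite -(EB lam_loc) ?gerBl// sub0r; ring.
  - by move=> x; rewrite R0E sub0r; apply: eq_integral => s _; rewrite addr0.
  - by move=> x x0; rewrite addr0 set_itvoc0 integral_set0 adde0.
have t0 := ltW t_gt0.
have [_ /(_ t_gt0)[bE RtE]] := RtP t.
have [_ /(_ t_gt0)[Zpos ZtE]] := ZtP t.
have /andP[w_ge0 _] := w_itv t t0.
have tw : t - w t = a t by rewrite /w subKr.
have qE := queue_massE w_ge0 RtE.
have QE : queue_mass (Rt t) = Q t by rewrite qE tw (ss_Q SS).
have ZE : service_mass (Zt t) = Z t.
  rewrite /service_mass (ZtE 0 (lexx 0)) add0r.
  rewrite (service_conv B Fh F0 F1 G_homo G0 G1 a_homo wE)// -EFin_tail/=.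
  by rewrite -KE// -cE// (ss_KZ SS t0); ring.
split => //.
- split; last first.
    by rewrite BE// bE -(EB lam_loc) ?gerBl// tw; ring.
  split => //; first exact: w_itv.
  apply: (Fd_inv' (w_itv t t0) qE).2 => x wx xt; rewrite QE tw.
  exact: (ss_can SS t0).
- by rewrite Zt0.
- apply/non_idlingP; rewrite QE ZE; split.
  + exact: (ss_Q_ge0 M SS).
  + exact: (ss_Z1 SS).
  + exact: (ss_QZ SS).
Unshelve. all: by end_near. Qed.

(** Equal queues give equal waiting times through [Fd_inv], then equal buffers, then equal [B] on
    nonnegative times; these fix the service integral. *)
Lemma fluid_solution_unique (Rt Zt Rt' Zt' : R -> fin_meas R) :
  fluid_solution F G lam w0 R0 Z0 Rt Zt ->
  fluid_solution F G lam w0 R0 Z0 Rt' Zt' ->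
  forall t, 0 <= t -> forall A : set (measurableTypeR R), measurable A ->
  Rt t A = Rt' t A /\ Zt t A = Zt' t A.
Proof.
move=> [w [B [sol0 solP]]] [w' [B' [sol0' solP']]].
have QQ := scalar_solution_unique fluid_model_data
  (fluid_solution_scalar sol0 solP) (fluid_solution_scalar sol0' solP').
have ww t : 0 <= t -> w t = w' t.
  move=> t0; have [_ [[_ _ ->] _] _ _ _] := solP t t0.
  by have [_ [[_ _ ->] _] _ _ _] := solP' t t0; rewrite QQ.
have RR t : 0 <= t ->
    forall A : set (measurableTypeR R), measurable A -> Rt t A = Rt' t A.
  move=> t0; apply: fin_meas_unique => x.
  have [_ _ -> _ _] := solP t t0; have [_ _ -> _ _] := solP' t t0.
  by rewrite ww.
have BB t : 0 <= t -> B t = B' t.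
  move=> t0; have [_ [_ ->] _ _ _] := solP t t0.
  by have [_ [_ ->] _ _ _] := solP' t t0; rewrite /buffer_mass RR.
have ZZ t x : 0 <= t -> 0 <= x -> Zt t (halfline x) = Zt' t (halfline x).
  move=> t0 x0; have [_ _ _ ZE _] := solP t t0.
  have [_ _ _ ZE' _] := solP' t t0; rewrite ZE// ZE'//; congr (_ + _)%E.
    have mh := measurable_itv `](x + t), +oo[.
    by have [_ ->] := sol0 _ mh; have [_ ->] := sol0' _ mh.
  transitivity (\int[lebesgue_stieltjes_measure B']_(s in `]0%R, t])
      (Fc (w s) * compl_dist G (x + t - s))%:E)%E.
    apply: eq_measure_integral => A mA At.
    exact: (stieltjes_unique BB mA At).
  apply: eq_integral => s; rewrite inE/= in_itv/= => /andP[s0 _].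
  by rewrite ww// ltW.
move=> t t0 A mA; split; first exact: RR.
apply: fin_meas_unique mA => x.
have [x0|/ltW x0] := leP 0 x; first exact: ZZ.
(* The service equation covers only half-lines starting at a nonnegative point; [on_positive]
   reduces the others to [halfline 0]. *)
have posE (Zm : fin_meas R) : on_positive Zm -> Zm (halfline x) = Zm (halfline 0).
  move=> Zpos; apply/eqP; rewrite -!EFin_tail eqe -subr_eq0 -eqe tailB// -measure_le0.
  rewrite -[leRHS]Zpos; apply: le_measure; rewrite ?inE//; try exact: measurable_itv.
  by move=> v /=; rewrite !in_itv/= => /andP[].
have [Zpos _ _ _ _] := solP t t0; have [Zpos' _ _ _ _] := solP' t t0.
by rewrite posE// posE// ZZ.
Qed.

End with_constant.
End fluid.

Theorem theorem2p1 (R : realType)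
    (dV : measure_display) (TV : measurableType dV) (PV : probability TV R)
    (V : {RV PV >-> R})
    (dS : measure_display) (TS : measurableType dS) (PS : probability TS R)
    (S : {RV PS >-> R})
    (F G : R -> R) (mu : R) (lam : R -> R) (w0 : R) (R0 Z0 : fin_meas R)
    (V_ge0 : forall v : TV, 0 <= V v) (S_ge0 : forall s : TS, 0 <= S s)
    (F_def : F = dist_fun V) (G_def : G = dist_fun S)
    (F_lip : lipschitz F)
    (G_cont : continuous G) (mu_gt0 : 0 < mu)
    (G_mean : 'E_PS[S]%E = (mu^-1)%:E)
    (lam_ge0 : forall t : R, 0 <= lam t)
    (lam_loc : locally_integrable setT lam)
    (init : valid_initial_state F lam w0 R0 Z0) :
  (exists Rt Zt : R -> fin_meas R, fluid_solution F G lam w0 R0 Z0 Rt Zt) /\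
  (forall Rt Zt Rt' Zt' : R -> fin_meas R,
     fluid_solution F G lam w0 R0 Z0 Rt Zt ->
     fluid_solution F G lam w0 R0 Z0 Rt' Zt' ->
     forall t : R, 0 <= t ->
     forall A : set (measurableTypeR R), measurable A ->
       Rt t A = Rt' t A /\ Zt t A = Zt' t A).
Proof.
subst F G; have [L L_ge0 FcL] := Fc_lipschitz F_lip; split.
  exact: (fluid_solution_exists V_ge0 S_ge0 G_cont lam_ge0 lam_loc init L_ge0 FcL).
exact: (fluid_solution_unique V_ge0 S_ge0 G_cont lam_ge0 lam_loc init L_ge0 FcL).
Qed.
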